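(* Let $p$ be a prime and let $(G,\cdot)$ be a residually-finite $p$-group of (finite) exponent $l$ that is generated by $d$ elements. If some automorphism of $G$ satisfies an identity of degree $m$ that is arithmetically-free over $\mathbb{F}_p$, then $G$ is finite and $$|G|\leq l^{\,d^{\,m^{2^m}+1}}.$$
   Context: Identities: an automorphism $f$ of a group $G$ satisfies an identity if there are constants $k\in\mathbb{N}$ and $m_1,\ldots,m_k,n_1,\ldots,n_k\in\mathbb{Z}$ such that for all $x\in G$, $$1_G=f^{m_1}(x^{n_1})\cdot f^{m_2}(x^{n_2})\cdots f^{m_k}(x^{n_k}).$$ The degree of the identity is $m=\max\{|m_s-m_t| \mid 1\leq s,t\leq k\}$. To this identity and a field $\mathbb{F}$ one associates the Laurent-polynomial $r_{\mathbb{F}}(z)=\sum_{1\leq t\leq k}n_t\cdot z^{m_t}\in\mathbb{F}[z,z^{-1}]$. The identity is arithmetically-free over $\mathbb{F}$ iff the set of roots of $r_{\mathbb{F}}(z)$ in $\overline{\mathbb{F}}^\times$ is an arithmetically-free subset of the multiplicative group $(\overline{\mathbb{F}}^\times,\cdot)$, where $\overline{\mathbb{F}}$ is an algebraic closure of $\mathbb{F}$. Arithmetically-free: a finite subset $X$ of an abelian group $(A,\cdot)$ is arithmetically-free iff there are no $x\in X$, $y\in X$ with $x\langle y\rangle\subseteq X$, where $\langle y\rangle$ is the cyclic subgroup generated by $y$. In particular arithmetically-free sets are finite (so $r_{\mathbb{F}}\neq 0$). *)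

(* Defs.v *)
From HB Require Import structures.
From mathcomp Require Import all_boot all_order all_algebra fingroup.
From mathcomp Require Import finmap all_classical.

Set Implicit Arguments.
Unset Strict Implicit.
Unset Printing Implicit Defensive.

Local Open Scope classical_set_scope.

Definition expgz (A : groupType) (x : A) (n : int) : A :=
  match n with
  | Posz k => (x ^+ k)%g
  | Negz k => (x ^- k.+1)%g
  end.

Definition cyclic_subgroup (A : groupType) (y : A) : set A :=
  [set expgz y n | n in [set: int]].

Definition is_subgroup (G : groupType) (H : set G) : Prop :=
  H 1%g /\ forall x y, H x -> H y -> H (x / y)%g.

(* The d generators are allowed to repeat. *)
Definition generated_by (d : nat) (G : groupType) : Prop :=
  exists g : 'I_d -> G, smallest (@is_subgroup G) (range g) = [set: G].

Definition residually_finite (G : groupType) : Prop :=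
  forall x : G, x != 1%g ->
  exists (H : finGroupType) (phi : {multiplicative G -> H}), phi x != 1%g.

Definition is_pgroup (p : nat) (G : groupType) : Prop :=
  forall x : G, exists n : nat, (x ^+ (p ^ n) = 1)%g.

(* The exponent is finite, and equal to l. *)
Definition has_exponent (l : nat) (G : groupType) : Prop :=
  [/\ (0 < l)%N,
      forall x : G, (x ^+ l = 1)%g &
      forall l' : nat, (0 < l')%N -> (forall x : G, (x ^+ l' = 1)%g) ->
        (l <= l')%N].

Record automorphism (G : groupType) := Automorphism {
  aut_fun :> {multiplicative G -> G};
  aut_inv : G -> G;
  aut_funK : cancel aut_fun aut_inv;
  aut_invK : cancel aut_inv aut_fun
}.

Definition autz (G : groupType) (f : automorphism G) (m : int) : G -> G :=
  match m with
  | Posz k => iter k f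
  | Negz k => iter k.+1 (aut_inv f)
  end.

Definition satisfies_identity (G : groupType) (f : automorphism G)
    (k : nat) (m n : 'I_k -> int) : Prop :=
  forall x : G, (1 = \prod_(t < k) autz f (m t) (expgz x (n t)))%g.

Definition identity_degree (k : nat) (m : 'I_k -> int) : nat :=
  \max_(s < k) \max_(t < k) `|m s - m t|%N.

(* Commutativity of A is not needed to state the notion; it is only used for
   the multiplicative group of a field. *)
Definition arithmetically_free (A : groupType) (X : set A) : Prop :=
  finite_set X /\
  ~ (exists x y : A,
       [/\ X x, X y & [set (x * z)%g | z in cyclic_subgroup y] `<=` X]).

(* The multiplicative group of an arbitrary field, as a groupType: the
   library's {unit R} is restricted to finite rings. *)
Section UnitGroup.
Local Open Scope ring_scope.
Import GRing.Theory.
Variable K : fieldType.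

Record unit_group := UnitGroup { unit_val :> K; unit_valP : unit_val != 0 }.

HB.instance Definition _ := [isSub for unit_val].
HB.instance Definition _ := [Choice of unit_group by <:].

Definition unit_one : unit_group := UnitGroup (oner_neq0 K).

Definition unit_mul (x y : unit_group) : unit_group :=
  UnitGroup (mulf_neq0 (unit_valP x) (unit_valP y)).

Lemma unit_inv_proof (x : unit_group) : (unit_val x)^-1 != 0.
Proof. by rewrite invr_eq0 unit_valP. Qed.

Definition unit_inv (x : unit_group) : unit_group :=
  UnitGroup (unit_inv_proof x).

Lemma unit_mulA : associative unit_mul.
Proof. by move=> x y z; apply/val_inj; rewrite /= mulrA. Qed.

Lemma unit_mul1 : left_id unit_one unit_mul.
Proof. by move=> x; apply/val_inj; rewrite /= mul1r. Qed.

Lemma unit_mulr1 : right_id unit_one unit_mul.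
Proof. by move=> x; apply/val_inj; rewrite /= mulr1. Qed.

Lemma unit_mulV : left_inverse unit_one unit_inv unit_mul.
Proof. by move=> x; apply/val_inj; rewrite /= mulVf ?unit_valP. Qed.

Lemma unit_mulVr : right_inverse unit_one unit_inv unit_mul.
Proof. by move=> x; apply/val_inj; rewrite /= mulfV ?unit_valP. Qed.

HB.instance Definition _ := isGroup.Build unit_group
  unit_mulA unit_mul1 unit_mulr1 unit_mulV unit_mulVr.

End UnitGroup.

Definition is_algebraic_closure (F : fieldType) (K : closedFieldType)
    (iota : {rmorphism F -> K}) : Prop :=
  integralRange iota.

(* The value at z of the Laurent polynomial sum_t n_t z^(m_t) over F, the
   coefficients being the images of the integers n_t in F; the powers of z are
   integer powers. *)
Definition laurent_value (F K : fieldType) (iota : {rmorphism F -> K})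
    (k : nat) (m n : 'I_k -> int) (z : K) : K :=
  (\sum_(t < k) iota (n t)%:~R * z ^ m t)%R.

Definition laurent_roots (F K : fieldType) (iota : {rmorphism F -> K})
    (k : nat) (m n : 'I_k -> int) : set (unit_group K) :=
  [set z : unit_group K | laurent_value iota m n z = 0%R].

(* K is meant to be an algebraic closure of F along iota. *)
Definition identity_arithmetically_free (F K : fieldType)
    (iota : {rmorphism F -> K}) (k : nat) (m n : 'I_k -> int) : Prop :=
  arithmetically_free (laurent_roots iota m n).

(* Main.v *)
Require Import Defs.
From HB Require Import structures.
From mathcomp Require Import finmap all_classical.
From mathcomp Require Import all_boot all_order all_algebra all_fingroup.
From mathcomp Require Import all_solvable mxabelem separable cyclotomic zify.

(** Every finite set of elements of G is separated by a quotient Q that is a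
finite p-group on which f acts: take the image of G under all its homomorphisms
to a fixed finite group. So it suffices to bound the order of such a Q, and,
because the i-th section of its lower central series is generated by d^i
commutators, it suffices to bound its nilpotency class.

Let L be the direct sum of the sections L_i/(L_{i+1} Phi(L_i)) of the lower
central series, extended to scalars in K, the algebraic closure of F_p. It is a
Lie algebra on which f acts with every eigenvalue a root of r. If f has order
p^e s with s prime to p, then g = f^(p^e) is diagonalizable, and its eigenspaces
grade L by Z/s. The support S of this grading embeds into the set of roots of r
(i goes to the p^e-th root of z^i, with z a primitive s-th root of unity), so
that |S| <= m and S is arithmetically free.

Such an L is soluble of derived length at most 2^|S| - 1 by Kreknin's argument,
which only uses that 0 is not in S. It is then nilpotent: when L' acts trivially
on an ideal B, the elements of L act on B by commuting operators, and |S| of them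
annihilate a homogeneous element, since the degrees obtained by applying some of
them, if they all stayed in S, would grow in number with each new operator. Thus
the sections vanish beyond the class bound, and by Burnside's basis theorem so
does the lower central series itself. *)

Set Implicit Arguments.
Unset Strict Implicit.
Unset Printing Implicit Defensive.
Import GRing.Theory Num.Theory.

(** * Graded Leibniz rings with arithmetically free support *)

Section GradedLeibniz.
Local Open Scope ring_scope.

Variables (s : nat) (L : zmodType) (br : L -> L -> L).
Hypothesis brBl : forall x y z, br (x - y) z = br x z - br y z.
Hypothesis brBr : forall x y z, br x (y - z) = br x y - br x z.
Hypothesis brA : forall x y z, br x (br y z) = br (br x y) z - br (br x z) y.

(* A family gives the homogeneous elements of each degree; the sum of the
   components is not assumed to be direct, and all series below are formed
   degree by degree. *)
Local Notation family := ('I_s.+1 -> L -> Prop).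

Let br0l z : br 0 z = 0. Proof. by have := brBl 0 0 z; rewrite !subrr. Qed.
Let br0r z : br z 0 = 0. Proof. by have := brBr z 0 0; rewrite !subrr. Qed.

Inductive zspan (P : L -> Prop) : L -> Prop :=
| zspan0 : zspan P 0
| zspan_base x : P x -> zspan P x
| zspanB x y : zspan P x -> zspan P y -> zspan P (x - y).

Definition zclosed (P : L -> Prop) :=
  P 0 /\ forall x y, P x -> P y -> P (x - y).

Lemma zspan_zclosed P : zclosed (zspan P).
Proof. by split; [exact: zspan0 | exact: zspanB]. Qed.

Lemma zspan_min (P Q : L -> Prop) x :
  zclosed Q -> (forall x, P x -> Q x) -> zspan P x -> Q x.
Proof. by move=> [Q0 QB] PQ; elim=> // y z _ Qy _ Qz; apply: QB. Qed.

Lemma zclosedD (P : L -> Prop) x y : zclosed P -> P x -> P y -> P (x + y).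
Proof.
move=> [P0 PB] Px Py; rewrite -[y]opprK.
by apply: (PB) => //; rewrite -[- y]sub0r; apply: (PB).
Qed.

Definition homprod (F H : family) : family := fun k =>
  zspan (fun z => exists i j x y,
    [/\ i + j = k, F i x, H j y & z = br x y]).

Definition subfamily (F H : family) := forall k x, F k x -> H k x.

Definition zfamily (F : family) := forall k, zclosed (F k).

Lemma homprod_zfamily F H : zfamily (homprod F H).
Proof. by move=> k; apply: zspan_zclosed. Qed.

Lemma homprodS F F' H H' : subfamily F F' -> subfamily H H' ->
  subfamily (homprod F H) (homprod F' H').
Proof.
move=> FF' HH' k x; apply: zspan_min; first exact: zspan_zclosed.
move=> _ [i [j [y [z [ijk Fy Hz ->]]]]]; apply: zspan_base.
by exists i, j, y, z; split; [| exact: FF' | exact: HH' |].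
Qed.

Lemma homprod_sub F H (Q : family) : zfamily Q ->
  (forall i j x y, F i x -> H j y -> Q (i + j) (br x y)) ->
  subfamily (homprod F H) Q.
Proof.
move=> zQ FHQ k x; apply: zspan_min => // _ [i [j [y [z [<- Fy Hz ->]]]]].
exact: FHQ.
Qed.

Lemma mem_homprod (F H : family) i j x y :
  F i x -> H j y -> homprod F H (i + j) (br x y).
Proof. by move=> Fx Hy; apply: zspan_base; exists i, j, x, y. Qed.

Definition graded_subalgebra (F : family) :=
  zfamily F /\ subfamily (homprod F F) F.

Definition der (F : family) := homprod F F.

Lemma der_subalgebra F : graded_subalgebra F -> graded_subalgebra (der F).
Proof.
by move=> [zF sF]; split; [exact: homprod_zfamily | exact: homprodS].
Qed.

Lemma iter_der_subalgebra t F :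
  graded_subalgebra F ->
  graded_subalgebra (iter t der F) /\ subfamily (iter t der F) F.
Proof.
move=> aF; elim: t => [|t [IH1 IH2]]; first by split.
split; first by rewrite iterS; apply: der_subalgebra.
by move=> k x /= dx; apply: IH2; apply: (proj2 IH1).
Qed.

Definition supported (S : {set 'I_s.+1}) (F : family) :=
  forall k x, k \notin S -> F k x -> x = 0.

Lemma supportedS S F H : subfamily F H -> supported S H -> supported S F.
Proof. by move=> FH sH k x nS /FH; apply: sH. Qed.

(** * Solubility by Kreknin's elimination of degrees *)

Section Kreknin.

(** Degrees add modulo [s.+1] but are compared through their representatives 0, ..., s; the
    elimination proceeds upwards in this order. *)
Inductive gen_from (F : family) (k : nat) : family :=
| gen_from0 i : gen_from F k i 0
| gen_from_base (i : 'I_s.+1) x : (k <= i)%N -> F i x -> gen_from F k i x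
| gen_fromB i x y : gen_from F k i x -> gen_from F k i y -> gen_from F k i (x - y)
| gen_from_br i j x y : gen_from F k i x -> gen_from F k j y -> gen_from F k (i + j) (br x y).

Lemma gen_from_sub F H k k' :
  (forall (i : 'I_s.+1) x, (k <= i)%N -> F i x -> gen_from H k' i x) ->
  subfamily (gen_from F k) (gen_from H k').
Proof.
move=> FH i x; elim=> {i x}.
- by move=> i; exact: gen_from0.
- exact: FH.
- by move=> i x y _ Hx _ Hy; exact: gen_fromB.
- by move=> i j x y _ Hx _ Hy; exact: gen_from_br.
Qed.

(* A sum i + j that wraps around modulo s.+1 is smaller than both i and j. *)
Lemma ord_add_ge (i j k : 'I_s.+1) : i + j = k -> (k <= j)%N ->
  i = 0 \/ (k < i)%N /\ (k < j)%N.
Proof.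
move=> /(congr1 val) /= ijk kj.
have [lt_ij|ge_ij] := ltnP (i + j) s.+1.
  by left; apply/val_inj; rewrite /=; rewrite modn_small // in ijk; lia.
right; have := ltn_ord i; have := ltn_ord j; move=> jlt ilt.
move: ijk; rewrite -(subnK ge_ij) modnDr modn_small; lia.
Qed.

(** Induction on the generation of [y]: the Leibniz identity turns [x,[y,y']] into left-normed
    products, whose last factor is generated in fewer steps. What remains are brackets whose right
    factor is a single component of degree at least [k]. *)
Lemma br_gen_from F (k : nat) i j x y : graded_subalgebra F -> F i x -> gen_from F k j y ->
  zspan (fun z => exists (u' v' : 'I_s.+1) u v,
    [/\ u' + v' = i + j, (k <= v')%N, F u' u, F v' v & z = br u v]) (br x y).
Proof.
move=> [zF sF] Fx gy; elim: gy i x Fx => {j y}.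
- by move=> j i x _; rewrite br0r; exact: zspan0.
- by move=> j y kj Fy i x Fx; apply: zspan_base; exists i, j, x, y.
- by move=> j y z _ IHy _ IHz i x Fx; rewrite brBr; apply: zspanB;
    [exact: IHy | exact: IHz].
- move=> j j' y y' gy IHy gy' IHy' i x Fx; rewrite brA.
  have memF l z : F l z -> forall l' z', gen_from F k l' z' -> F (l + l') (br z z').
    move=> Fz l' z' gz; elim: gz l z Fz => {l' z'}.
    + by move=> l' l z _; rewrite br0r; case: (zF (l + l')).
    + by move=> l' z' _ Fz' l z Fz; apply: sF; apply: mem_homprod.
    + move=> l' z1 z2 _ IH1 _ IH2 l z Fz; rewrite brBr.
      by apply: (proj2 (zF _)); [exact: IH1 | exact: IH2].
    + move=> l1 l2 z1 z2 _ IH1 _ IH2 l z Fz; rewrite brA.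
      apply: (proj2 (zF _)); first by rewrite addrA; apply/IH2/IH1.
      by rewrite [l1 + l2]addrC addrA; apply/IH1/IH2.
  apply: zspanB.
    by rewrite addrA; apply: IHy'; apply: memF.
  by rewrite [j + j']addrC addrA; apply: IHy; apply: memF.
Qed.

(** After [br_gen_from] the right factor of each bracket has degree at least [k]. As the degrees add
    up to [k], either the left factor has degree 0 and vanishes, or the sum wraps around and both
    degrees exceed [k]. *)
Lemma Kreknin_step F k (S : {set 'I_s.+1}) : 0 \notin S ->
  graded_subalgebra F -> supported S F ->
  forall (kk : 'I_s.+1) i j x y, kk = k :> nat ->
  F i x -> F j y -> gen_from F k j y -> i + j = kk -> gen_from F k.+1 kk (br x y).
Proof.
move=> S0 aF suppF kk i j x y kkk Fx Fy gy ijk.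
have := br_gen_from aF Fx gy; rewrite ijk; apply: zspan_min.
  by split; [exact: gen_from0 | exact: gen_fromB].
move=> _ [u' [v' [u [v [uvk kv Fu Fv ->]]]]].
rewrite -kkk in kv *; case: (ord_add_ge uvk kv) => [u0|[ku kv']].
  have -> : u = 0 by apply: (suppF u') => //; rewrite u0.
  by rewrite br0l; exact: gen_from0.
by rewrite -{2}uvk; apply: gen_from_br; apply: gen_from_base.
Qed.

(* Each degree of the support up to k costs a doubling: the first half of the derived
   series moves the degree k part into the algebra generated in degrees > k, and the
   second half starts from the resulting subalgebra. *)
Lemma Kreknin_gen_from (S : {set 'I_s.+1}) (k : nat) F : 0 \notin S -> (k <= s)%N ->
  graded_subalgebra F -> supported S F ->
  subfamily (iter (2 ^ #|[set i in S | (i <= k)%N]|).-1 der F) (gen_from F k.+1).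
Proof.
move=> S0; elim: k F => [|k IH] F ks aF suppF.
  (* As 0 lies outside [S], no derived step is taken and [F] is itself generated in positive
     degrees. *)
  have -> : [set i in S | (i <= 0)%N] = set0.
    apply/setP=> i; rewrite !inE leqn0; apply/negP => /andP[iS /eqP i0].
    by move: S0; rewrite (_ : 0 = i) ?iS //; apply/val_inj.
  rewrite cards0 /= => i x Fx; case: (posnP i) => [i0|i0].
    rewrite (suppF i x) //; first exact: gen_from0.
    by rewrite (_ : i = 0) //; apply/val_inj.
  exact: gen_from_base.
pose kk : 'I_s.+1 := Ordinal (n:=s.+1) (m:=k.+1) ks.
set c := #|[set i in S | (i <= k)%N]| in IH *.
have [kS|kS] := boolP (kk \in S); last first.
  have -> : [set i in S | (i <= k.+1)%N] = [set i in S | (i <= k)%N].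
    apply/setP=> i; rewrite !inE; case iS: (i \in S) => //=.
    rewrite leq_eqVlt ltnS; case: eqP => // ik.
    by move: kS; rewrite (_ : kk = i) ?iS //; apply/val_inj.
  move=> i x /(IH F (ltnW ks) aF suppF); apply: gen_from_sub => {x}i x ki Fx.
  have [ik|ik] := eqVneq (i : nat) k.+1.
    rewrite (suppF i x) //; first exact: gen_from0.
    by rewrite (_ : i = kk) //; apply/val_inj.
  by apply: gen_from_base => //; rewrite ltn_neqAle eq_sym ik.
have -> : #|[set i in S | (i <= k.+1)%N]| = c.+1.
  rewrite (cardsD1 kk) !inE kS leqnn add1n; congr _.+1.
  apply: eq_card => i; rewrite !inE -(inj_eq val_inj) /=.
  by case: (i \in S); rewrite ?andbF //=; lia.
have c_gt0 : (0 < 2 ^ c)%N by rewrite expn_gt0.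
have -> : (2 ^ c.+1).-1 = ((2 ^ c).-1 + (2 ^ c).-1.+1)%N.
  by rewrite expnS prednK // mul2n -addnn -!subn1; lia.
rewrite iterD; set N := iter (2 ^ c).-1.+1 der F.
have [aN NF] := iter_der_subalgebra (2 ^ c).-1.+1 aF.
move=> i x /(IH N (ltnW ks) aN (supportedS NF suppF)).
apply: gen_from_sub => {x}i x ki Nx.
have [ik|ik] := eqVneq (i : nat) k.+1; last first.
  by apply: gen_from_base; [rewrite ltn_neqAle eq_sym ik | exact: NF].
have ikk : i = kk by apply/val_inj.
subst i.
(* The last of the 2^c derived steps in [N] makes a degree k+1 element a sum of brackets of elements
   of the derived term of index 2^c - 1. The induction hypothesis applies to those factors, which is
   what [Kreknin_step] asks for. *)
move: Nx; rewrite /N iterS /=; apply: zspan_min.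
  by split; [exact: gen_from0 | exact: gen_fromB].
move=> _ [i [j [y [z [ijk Ny Nz ->]]]]].
have [_ sF] := iter_der_subalgebra (2 ^ c).-1 aF.
by apply: (Kreknin_step S0 aF suppF _ (sF _ _ Ny) (sF _ _ Nz)
   (IH F (ltnW ks) aF suppF _ _ Nz)).
Qed.

(** Once all degrees up to [s] are eliminated, no generators are left. *)
Lemma Kreknin (S : {set 'I_s.+1}) F : 0 \notin S ->
  graded_subalgebra F -> supported S F ->
  supported set0 (iter (2 ^ #|S|).-1 der F).
Proof.
move=> S0 aF suppF k x _.
have -> : S = [set i in S | (i <= s)%N].
  by apply/setP=> i; rewrite inE -ltnS ltn_ord andbT.
move=> /(Kreknin_gen_from S0 (leqnn s) aF suppF) gx; elim: gx => //.
- by move=> i y; rewrite leqNgt ltn_ord.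
- by move=> i y z _ -> _ ->; rewrite subrr.
- by move=> i j y z _ -> _ _; rewrite br0l.
Qed.

End Kreknin.

(** * From solubility to nilpotency, using arithmetic freeness *)

Section Nilpotency.

(* Indices start at 0: lcs F 0 = F. *)
Definition lcs (F : family) (q : nat) : family :=
  iter q (fun H => homprod H F) F.

Definition ideal_of (F B : family) := zfamily B /\ subfamily (homprod B F) B.

(** Right multiplication by [y] is a derivation, [[u,v],y] = [[u,y],v] + [u,[v,y]], so stability
    under [F] passes from one term to the next. *)
Lemma lcs_ideal F q : graded_subalgebra F ->
  ideal_of F (lcs (der F) q) /\ subfamily (lcs (der F) q) F.
Proof.
move=> [zF sF]; elim: q => [|q [[zB sB] BF]].
  split=> //; split; first exact: homprod_zfamily.
  by apply: homprodS => // k x; apply: sF.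
have bF i j x y : F i x -> F j y -> F (i + j) (br x y).
  by move=> Fx Fy; apply: sF; apply: mem_homprod.
have bB i j x y : lcs (der F) q i x -> F j y -> lcs (der F) q (i + j) (br x y).
  by move=> Bx Fy; apply: sB; apply: mem_homprod.
split; last first.
  move=> k x /= Bx; apply: BF; move: k x Bx.
  apply: homprod_sub => // i j x y Bx Dy; apply: bB => //; exact: sF.
split; first exact: homprod_zfamily.
apply: homprod_sub; first exact: homprod_zfamily.
move=> k j x y Bx Fy; move: Bx => /=; apply: (zspan_min (Q := fun x =>
  homprod (lcs (der F) q) (der F) (k + j) (br x y))).
  split; first by rewrite br0l; exact: zspan0.
  by move=> u v; rewrite brBl; exact: zspanB.
move=> _ [i [l [u [v [<- Bu Dv ->]]]]].
have -> : br (br u v) y = br (br u y) v + br u (br v y).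
  by rewrite brA addrC subrK.
apply: zclosedD; first exact: homprod_zfamily.
  rewrite -addrA [l + j]addrC addrA; apply: mem_homprod => //.
  exact: bB.
rewrite -addrA; apply: mem_homprod => //.
by apply: mem_homprod => //; apply: sF.
Qed.

(** The group of degrees is finite, so the natural multiples of [j] already exhaust the subgroup it
    generates. *)
Definition arith_free (S : {set 'I_s.+1}) :=
  forall i j, i \in S -> j \in S -> exists k : nat, i + j *+ k \notin S.

Lemma arith_free0 S : arith_free S -> 0 \notin S.
Proof.
move=> fS; apply/negP => S0; have [k] := fS _ _ S0 S0.
by rewrite mul0rn addr0 S0.
Qed.

(* A set of partial sums contained in S and stable under adding j would contain
   a coset of the subgroup generated by j; so every new term adds a partial sum. *)
Lemma subset_sum_escape S i (js : seq 'I_s.+1) : arith_free S ->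
  i \in S -> all (mem S) js -> (#|S| <= size js)%N ->
  exists m, i + \sum_(j <- mask m js) j \notin S.
Proof.
move=> fS iS jsS Sjs; apply: contrapT => nex; move: Sjs; apply/negP; rewrite -ltnNge.
have allS m : i + \sum_(j <- mask m js) j \in S.
  by apply/negPn/negP => nS; apply: nex; exists m.
suff [T [lTS ]] : exists T : {set 'I_s.+1}, (size js < #|T|)%N /\
    (forall x, x \in T -> exists m, x = i + \sum_(j <- mask m js) j).
  move=> TS; apply: (leq_trans lTS); apply: subset_leq_card.
  by apply/subsetP => x /TS[m ->].
elim: js jsS allS {nex} => [|j js IH] /= jsS allS.
  exists [set i]; rewrite cards1; split=> // x /set1P ->.
  by exists [::]; rewrite big_nil addr0.
case/andP: jsS => jS jsS.
have [T [cT memT]] := IH jsS (fun m => allS (false :: m)).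
pose T' := T :|: [set x + j | x in T].
exists T'; split; last first.
  move=> x /setUP[/memT[m ->]|/imsetP[y /memT[m ->] ->]].
    by exists (false :: m).
  by exists (true :: m); rewrite /= big_cons [j + _]addrC addrA.
have [/subsetP TT|nTT] := boolP ([set x + j | x in T] \subset T).
  have [x xT] : exists x, x \in T by apply/card_gt0P; apply: leq_trans cT.
  have xS : x \in S by have [m ->] := memT _ xT; exact: (allS (false :: m)).
  have [k /negP[]] := fS _ _ xS jS.
  suff kT : x + j *+ k \in T.
    by have [m ->] := memT _ kT; exact: (allS (false :: m)).
  elim: k => [|k kT]; first by rewrite mulr0n addr0.
  by rewrite mulrSr addrA; apply: TT; apply: imset_f.
apply: leq_ltn_trans cT _; apply: proper_card; rewrite properE subsetUl /=.
by apply: contra nTT => /(subset_trans (subsetUr _ _)).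
Qed.

Definition act (x : L) (ys : seq ('I_s.+1 * L)) : L :=
  foldl (fun u y => br u y.2) x ys.

Lemma actB x y zs : act (x - y) zs = act x zs - act y zs.
Proof. by elim: zs x y => //= z zs IH x y; rewrite brBl IH. Qed.

Lemma mem_act F B i x ys : ideal_of F B -> B i x ->
  (forall y, y \in ys -> F y.1 y.2) ->
  B (i + \sum_(j <- map fst ys) j) (act x ys).
Proof.
move=> [zB sB]; elim: ys i x => [|y ys IH] i x Bx Fys /=.
  by rewrite big_nil addr0.
rewrite big_cons addrA; apply: IH; last first.
  by move=> z zys; apply: Fys; rewrite inE zys orbT.
by apply: sB; apply: mem_homprod => //; apply: Fys; rewrite inE eqxx.
Qed.

(* Since F' maps B into C, the elements of F act on B by commuting operators
   modulo C. *)
Lemma act_mask F B C i x ys m : graded_subalgebra F ->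
  ideal_of F B -> ideal_of F C -> subfamily (homprod B (der F)) C ->
  B i x -> (forall y, y \in ys -> F y.1 y.2) -> size m = size ys ->
  C (i + \sum_(j <- map fst ys) j)
    (act x ys - act x (mask m ys ++ mask (map negb m) ys)).
Proof.
move=> aF iB iC BDC.
have Cz k : zclosed (C k) by case: iC.
have bB l j u y : B l u -> F j y -> B (l + j) (br u y).
  by move=> Bx Fy; apply: (proj2 iB); apply: mem_homprod.
elim: ys m i x => [|y ys IH] [|b m] i x Bx Fys //=.
  by move=> _; rewrite subrr; case: (Cz (i + \sum_(j <- [::]) j)).
move=> [sz].
have Fy : F y.1 y.2 by apply: Fys; rewrite inE eqxx.
have {}Fys z : z \in ys -> F z.1 z.2 by move=> zy; apply: Fys; rewrite inE zy orbT.
rewrite big_cons addrA.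
case: b => /=; first by apply: IH => //; exact: bB.
rewrite -[act _ ys](subrK (act (br x y.2) (mask m ys ++ mask (map negb m) ys))).
rewrite -[_ + _ - act x _]addrA; apply: zclosedD => //.
  by apply: IH => //; exact: bB.
have Fmask m' z : z \in mask m' ys -> F z.1 z.2 by move/mem_mask/Fys.
have -> : \sum_(j <- map fst ys) j =
   \sum_(j <- map fst (mask m ys)) j + \sum_(j <- map fst (mask (map negb m) ys)) j.
  elim: (m) (ys) sz => [|b m' IHm] [|z ys'] //=; first by rewrite !big_nil addr0.
  by move=> [sz]; case: b; rewrite /= !big_cons (IHm ys') //; [rewrite addrA | rewrite addrCA].
(* It remains to carry the unselected [y] past the selected operators [M]. Exchanging it with [z]
   costs the term [x,[y,z]], which lies in [C] because [y,z] lies in F'; the remaining operators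
   keep it there. *)
move: (mask m ys) (mask (map negb m) ys) (Fmask m) (Fmask (map negb m)).
move=> M N FM FN {IH sz Fmask}.
elim: M i x Bx FM => [|z M IHM] i x Bx FM /=.
  by rewrite subrr; case: (Cz (i + y.1 + (\sum_(j <- [::]) j + \sum_(j <- map fst N) j))).
have Fz : F z.1 z.2 by apply: FM; rewrite inE eqxx.
have {}FM w : w \in M -> F w.1 w.2 by move=> wM; apply: FM; rewrite inE wM orbT.
rewrite -[act _ (M ++ N)](subrK (act (br (br x z.2) y.2) (M ++ N))).
rewrite -[_ + _ - act _ (_ ++ _ :: _)]addrA; apply: zclosedD => //; last first.
  have := IHM _ _ (bB _ _ _ _ Bx Fz) FM.
  by rewrite big_cons -!addrA [y.1 + (z.1 + _)]addrCA.
rewrite -actB -brA.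
have -> : i + y.1 + (\sum_(j <- z.1 :: map fst M) j + \sum_(j <- map fst N) j) =
    i + (y.1 + z.1) + \sum_(j <- map fst (M ++ N)) j.
  by rewrite big_cons map_cat big_cat /= !addrA.
apply: (mem_act iC) => [|w]; last by rewrite mem_cat => /orP[/FM|/FN].
by apply: BDC; apply: mem_homprod => //; apply: mem_homprod.
Qed.

(** If all degrees involved lie in [S], some of the operators have degrees leading from [i] out of
    [S]. Modulo [C] these can be applied first, and they give an element of [F] of degree outside
    [S], that is 0. *)
Lemma act_escape F B C S i x ys : graded_subalgebra F -> supported S F ->
  arith_free S -> ideal_of F B -> subfamily B F -> ideal_of F C ->
  subfamily (homprod B (der F)) C ->
  B i x -> (forall y, y \in ys -> F y.1 y.2) -> (#|S| <= size ys)%N ->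
  C (i + \sum_(j <- map fst ys) j) (act x ys).
Proof.
move=> aF suppF fS iB BF iC BDC Bx Fys Sys.
have Cz k : C k 0 by case: (proj1 iC k).
have act0 zs : act 0 zs = 0 by elim: zs => //= z zs; rewrite br0l.
have [iS|iS] := boolP (i \in S); last first.
  by rewrite (suppF i x) ?act0 //; exact: BF.
have [|nall] := boolP (all (mem S) (map fst ys)); last first.
  suff -> : act x ys = 0 by exact: Cz.
  elim: ys x Fys nall {Sys Bx} => //= y ys IH x Fys.
  rewrite negb_and => /orP[nyS|nall].
    rewrite (suppF y.1 y.2) ?br0r ?act0 //.
    by apply: Fys; rewrite inE eqxx.
  by apply: IH => // z zys; apply: Fys; rewrite inE zys orbT.
rewrite -(size_map fst) in Sys => jsS.
have [m0 esc] := subset_sum_escape fS iS jsS Sys.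
(* [m0] has arbitrary length; cutting and padding it to the length of [ys] leaves the selection
   unchanged and fits [act_mask]. *)
pose m := take (size ys) (m0 ++ nseq (size ys) false).
have szm : size m = size ys by rewrite size_takel // size_cat size_nseq leq_addl.
have mE : mask m ys = mask m0 ys.
  have mtake q zs : mask (take (size zs) q) zs = mask q zs :> seq ('I_s.+1 * L).
    by elim: zs q => [|z zs IHz] [|b q] //=; rewrite ?IHz.
  have mcat q k zs : mask (q ++ nseq k false) zs = mask q zs :> seq ('I_s.+1 * L).
    elim: q zs => [|b q IHq] zs /=; first by rewrite mask_false; case: zs.
    by case: zs => //= z zs; rewrite IHq.
  by rewrite /m mtake mcat.
have := act_mask aF iB iC BDC Bx Fys szm.
have -> : act x (mask m ys ++ mask (map negb m) ys) = 0.
  rewrite /act foldl_cat -/(act x _) -/(act (act x _) _) (_ : act x _ = 0) //.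
  apply: (suppF _ _ esc); rewrite -map_mask -mE; apply: BF.
  by apply: (mem_act iB) => // y /mem_mask/Fys.
by rewrite subr0.
Qed.

Lemma lcs_step F B C S : graded_subalgebra F -> supported S F ->
  arith_free S -> ideal_of F B -> subfamily B F -> ideal_of F C ->
  subfamily (homprod B (der F)) C ->
  subfamily (iter #|S| (fun H => homprod H F) B) C.
Proof.
move=> aF suppF fS iB BF iC BDC.
(* The right factors are peeled off one at a time; [ys] stores those already removed, until all #|S|
   act on an element of [B]. *)
suff step n ys : (forall y : 'I_s.+1 * L, y \in ys -> F y.1 y.2) -> (n + size ys = #|S|)%N ->
    forall k x, iter n (fun H => homprod H F) B k x ->
    C (k + \sum_(j <- map fst ys) j) (act x ys).
  move=> k x /(step _ [::]); rewrite addn0 big_nil addr0; exact.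
elim: n ys => [|n IH] ys Fys sz k x /=.
  by move=> Bx; apply: (act_escape aF suppF fS iB) => //; rewrite -sz.
apply: (zspan_min (Q := fun x => C (k + _) (act x ys))).
  split; first by have := actB 0 0 ys; rewrite !subrr => ->;
    case: (proj1 iC (k + \sum_(j <- map fst ys) j)).
  by move=> u v Cu Cv; rewrite actB; apply: (proj2 (proj1 iC _)).
move=> _ [i [j [u [v [<- Bu Fv ->]]]]].
have := IH ((j, v) :: ys) _ _ i u Bu; rewrite /= big_cons addrA; apply.
  by move=> y; rewrite inE => /orP[/eqP -> //|/Fys].
by rewrite addnS -addSn.
Qed.

(* 1 + n + ... + n^(t-1) *)
Fixpoint class_bound (n t : nat) : nat :=
  if t is t'.+1 then (n * class_bound n t').+1 else 0.

Lemma lcsD F q r : lcs F (q + r) = iter q (fun H => homprod H F) (lcs F r).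
Proof. by rewrite /lcs iterD. Qed.

Lemma iter_homprodS n F B C : subfamily B C ->
  subfamily (iter n (fun H => homprod H F) B) (iter n (fun H => homprod H F) C).
Proof. by move=> BC; elim: n => //= n IH; apply: homprodS. Qed.

(** Induction on the derived length, applied to F'. One step leads from [F] to F', and by [lcs_step]
    every further step down the lower central series of F' costs #|S| multiplications by [F]; this
    is the recursion of [class_bound]. *)
Lemma soluble_nilpotent S F t : arith_free S ->
  graded_subalgebra F -> supported S F ->
  supported set0 (iter t der F) -> supported set0 (lcs F (class_bound #|S| t)).
Proof.
move=> fS; elim: t F => [|t IH] F aF suppF; first by [].
rewrite iterSr => /(IH _ (der_subalgebra aF)) IH'.
have suppD : supported S (der F) by apply: supportedS suppF; case: aF.
have {IH'} suppc := IH' suppD; apply: supportedS suppc.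
have -> : class_bound #|S| t.+1 = (#|S| * class_bound #|S| t + 1)%N by rewrite addn1.
rewrite lcsD; move: (class_bound #|S| t) => c.
suff sub q : subfamily (iter (#|S| * q) (fun H => homprod H F) (der F)) (lcs (der F) q).
  exact: sub.
elim: q => [|q IHq]; first by rewrite muln0.
rewrite mulnS iterD => k x /(iter_homprodS IHq).
have [iB BF] := lcs_ideal q aF; have [iC _] := lcs_ideal q.+1 aF.
by apply: (lcs_step aF suppF fS iB BF iC).
Qed.

End Nilpotency.

Lemma graded_nilpotent S F : arith_free S ->
  graded_subalgebra F -> supported S F ->
  supported set0 (lcs F (class_bound #|S| (2 ^ #|S|).-1)).
Proof.
move=> fS aF suppF; apply: soluble_nilpotent => //.
exact: Kreknin (arith_free0 fS) aF suppF.
Qed.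

Definition total (F : family) : L -> Prop := zspan (fun x => exists k, F k x).

Lemma total_br F H x y : total F x -> total H y -> total (homprod F H) (br x y).
Proof.
move=> tx ty; elim: tx => [|u [i Fu]|u v _ IHu _ IHv].
- by rewrite br0l; exact: zspan0.
- elim: ty => [|v [j Hv]|v w _ IHv _ IHw].
  + by rewrite br0r; exact: zspan0.
  + by apply: zspan_base; exists (i + j); exact: mem_homprod.
  + by rewrite brBr; exact: zspanB.
- by rewrite brBl; exact: zspanB.
Qed.

Lemma total_eq0 F x : supported set0 F -> total F x -> x = 0.
Proof.
move=> F0; elim=> // [y [k Fy]|y z _ -> _ ->]; last by rewrite subrr.
by apply: (F0 k) => //; rewrite inE.
Qed.

End GradedLeibniz.

(** For n at least 2 the geometric sum is below n^t; the values 0 and 1 of n are evaluated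
    directly. *)
Lemma class_bound_le n m : (n <= m)%N ->
  (class_bound n (2 ^ n).-1 <= m ^ (2 ^ m))%N.
Proof.
move=> nm; case: n nm => [|n] nm; first by rewrite expn0.
have bound k t : (class_bound k.+2 t < k.+2 ^ t)%N.
  elim: t => //= t IH; rewrite expnS; apply: (@leq_trans (k.+2 * (class_bound k.+2 t).+1)).
    by rewrite mulnS; lia.
  by rewrite leq_mul2l IH orbT.
apply: (@leq_trans (n.+1 ^ (2 ^ n.+1))); last first.
  apply: (@leq_trans (m ^ (2 ^ n.+1))); first by rewrite leq_exp2r // expn_gt0.
  by rewrite leq_pexp2l ?leq_pexp2l //; apply: leq_trans nm.
case: n {nm} => [//|n]; apply: leq_trans (ltnW (bound _ _)) _.
by rewrite leq_pexp2l // leq_pred.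
Qed.

(** * Coordinates on the sections of the lower central series *)

Section LowerCentralSections.
Local Open Scope group_scope.
Variable gT : finGroupType.
Implicit Types (A N G : {group gT}) (W : zmodType).

Definition additive_on W (A : {set gT}) (h : gT -> W) :=
  {in A &, forall x y, h (x * y) = (h x + h y)%R}.

Section AdditiveOn.
Variables (W : zmodType) (A : {group gT}) (h : gT -> W).
Hypothesis hA : additive_on A h.

Lemma additive_on1 : h 1 = 0%R.
Proof. by apply: (addIr (h 1)); rewrite -hA ?group1 // mulg1 add0r. Qed.

Lemma additive_onV x : x \in A -> h x^-1 = (- h x)%R.
Proof.
by move=> Ax; apply: (addIr (h x)); rewrite -hA ?groupV // mulVg addNr additive_on1.
Qed.

Lemma additive_onX x n : x \in A -> h (x ^+ n) = (h x *+ n)%R.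
Proof.
move=> Ax; elim: n => [|n IH]; first by rewrite additive_on1.
by rewrite expgS mulrS hA ?groupX // IH.
Qed.

Lemma additive_on_prod I (r : seq I) (P : pred I) (F : I -> gT) :
  (forall i, P i -> F i \in A) ->
  h (\prod_(i <- r | P i) F i) = (\sum_(i <- r | P i) h (F i))%R.
Proof.
move=> AF; elim: r => [|i r IH]; first by rewrite !big_nil additive_on1.
rewrite !big_cons; case: ifP => // Pi.
by rewrite hA ?IH ?AF // group_prod.
Qed.

Lemma additive_on_gen (Q : W -> Prop) (X : {set gT}) :
  Q 0%R -> (forall u v, Q u -> Q v -> Q (u - v)%R) ->
  X \subset A -> {in X, forall x, Q (h x)} -> {in <<X>>, forall x, Q (h x)}.
Proof.
move=> Q0 QB XA QX.
have QN u : Q u -> Q (- u)%R by move=> Qu; rewrite -sub0r; apply: QB.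
pose B := [set x in A | `[< Q (h x) >]].
have gB : group_set B.
  apply/group_setP; split.
    by rewrite inE group1 /=; apply/asboolP; rewrite additive_on1.
  move=> x y; rewrite !inE => /andP[Ax /asboolP Qx] /andP[Ay /asboolP Qy].
  rewrite groupM //=; apply/asboolP; rewrite hA // -[(h y)%R]opprK.
  by apply: QB => //; apply: QN.
have sXB : <<X>> \subset Group gB.
  rewrite gen_subG; apply/subsetP => x Xx; rewrite inE (subsetP XA) //=.
  by apply/asboolP/QX.
by move=> x /(subsetP sXB); rewrite inE => /andP[_ /asboolP].
Qed.

Lemma additive_on_gen0 (X : {set gT}) :
  X \subset A -> {in X, forall x, h x = 0%R} -> {in <<X>>, forall x, h x = 0%R}.
Proof.
move=> XA hX; apply: (additive_on_gen (Q := fun u => u = 0%R)) => //.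
by move=> u v -> ->; rewrite subrr.
Qed.

End AdditiveOn.

(** Induction on [j], with the three subgroups lemma in the quotient by the right-hand side. *)
Lemma comm_lcn G i j : [~: 'L_i.+1(G), 'L_j.+1(G)] \subset 'L_(i + j).+2(G).
Proof.
elim: j i => [|j IH] i; first by rewrite addn0.
set N := 'L_(i + j.+1).+2(G).
have nN k : 'L_k(G) \subset 'N(N).
  by apply: subset_trans (lcn_sub _ _) (lcn_norm _ _).
have nNG : G \subset 'N(N) by exact: lcn_norm.
rewrite lcnSn commGC -quotient_cents2 //; last first.
  by apply: subset_trans nNG; rewrite comm_subG ?lcn_sub.
rewrite quotientR //; apply/commG1P; apply: three_subgroup.
  apply/commG1P; rewrite /= -quotientR // quotient_cents2 //;
    last by apply: subset_trans nNG; rewrite comm_subG ?lcn_sub.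
  have := IH i.+1; rewrite /N addSnnS; apply: subset_trans.
  by apply: commSg; rewrite commGC -lcnSn.
apply/commG1P; rewrite /= -quotientR // quotient_cents2 //;
  last by apply: subset_trans nNG; rewrite comm_subG ?lcn_sub.
rewrite /N addnS.
exact: (commSg G (IH i)).
Qed.

Lemma section_basis p A N : prime p -> N <| A -> p.-abelem (A / N) ->
  exists (n : nat) (b : 'I_n -> gT) (phi : 'I_n -> gT -> 'F_p),
  [/\ forall a, b a \in A,
      forall a, additive_on A (phi a),
      forall a, {in N, forall x, phi a x = 0%R},
      forall a c, phi a (b c) = (a == c)%:R%R &
      {in A, forall x, exists2 k, k \in N & x = \prod_a b a ^+ phi a x * k}].
Proof.
(* The row vector model of an elementary abelian group requires it to be nontrivial, so the trivial
   quotient gets an empty basis separately. *)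
move=> p_pr nsNA abA; have [AN1|ntA] := eqVneq (A / N) 1.
  exists 0, (fun=> 1), (fun _ _ => 0%R); split=> //; try by case.
  move=> x Ax; exists x; last by rewrite big_ord0 mul1g.
  have := mem_quotient N Ax; rewrite AN1 => /set1P/coset_idr; apply.
  exact: (subsetP (normal_norm nsNA)).
pose rv := abelem_rV abA ntA; pose vr := rVabelem abA ntA.
have nNA := subsetP (normal_norm nsNA).
have liftP u : exists2 x, x \in A & coset N x = vr u.
  by have /morphimP[x _ Ax e] := mem_rVabelem abA ntA u; exists x => //; apply/esym.
pose b a := s2val (cid2 (liftP (delta_mx 0 a)%R)).
have bA a : b a \in A by rewrite /b; case: cid2.
have bE a : coset N (b a) = vr (delta_mx 0 a)%R by rewrite /b; case: cid2.
exists _, b, (fun a x => rv (coset N x) ord0 a); split=> //.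
- move=> a x y Ax Ay; rewrite morphM ?nNA //= /rv abelem_rV_M ?mem_quotient //.
  by rewrite mxE.
- by move=> a x Nx; rewrite coset_id // /rv abelem_rV_1 mxE.
- by move=> a c; rewrite bE /rv rVabelemK mxE eqxx eq_sym.
- move=> x Ax; set y := \prod_a _.
  have Ay : y \in A by apply: group_prod => a _; rewrite groupX.
  exists (y^-1 * x); last by rewrite mulKVg.
  apply: coset_idr; first by rewrite groupM ?groupV ?nNA.
  rewrite morphM ?morphV ?groupV ?nNA //=; apply/eqP; rewrite -eq_mulVg1.
  apply/eqP/(abelem_rV_inj (abelE := abA) (ntE := ntA)); rewrite ?mem_quotient //.
  rewrite /y [LHS](additive_on_prod (A := A)
    (h := fun z => abelem_rV abA ntA (coset N z))).
  - rewrite [RHS]row_sum_delta; apply: eq_bigr => a _.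
    rewrite morphX ?nNA //= bE abelem_rV_X ?mem_rVabelem // rVabelemK.
    by rewrite natr_Zp.
  - by move=> z t Az At; rewrite morphM ?nNA //= abelem_rV_M ?mem_quotient.
  - by move=> a _; rewrite groupX.
Qed.

(** In a p-group the Frattini subgroup is generated by commutators and p-th powers, and an additive
    map into a group of exponent dividing [p] kills both. *)
Lemma additive_on_Phi (p : nat) A N (W : zmodType) (h : gT -> W) :
  p.-group A -> (forall w : W, w *+ p = 0)%R ->
  additive_on A h -> {in N, forall x, h x = 0%R} -> N \subset A ->
  {in 'Phi(A) <*> N, forall x, h x = 0%R}.
Proof.
move=> pA pW hA hN NA.
have hPhi : {in 'Phi(A), forall x, h x = 0%R}.
  rewrite (Phi_joing pA) (MhoE _ pA) /joing.
  apply: (additive_on_gen0 hA) => //.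
  - rewrite subUset der_sub gen_subG.
    by apply/subsetP => _ /imsetP[x Ax ->]; rewrite groupX.
  move=> x /setUP[].
    move: x; rewrite /derived_at /=.
    apply: (additive_on_gen0 hA) => //.
    - by apply/subsetP => _ /imset2P[x y Ax Ay ->]; rewrite groupR.
    move=> _ /imset2P[x y Ax Ay ->]; rewrite /commg /conjg.
    rewrite !hA ?groupM ?groupV // !(additive_onV hA) //.
    by rewrite [(h x + h y)%R]addrC addKr addNr.
  move: x.
  apply: (additive_on_gen0 hA) => //.
  - by apply/subsetP => _ /imsetP[x Ax ->]; rewrite groupX.
  by move=> _ /imsetP[x Ax ->]; rewrite (additive_onX hA) // expn1 pW.
apply: (additive_on_gen0 hA) => //.
- by rewrite subUset Phi_sub.
by move=> x /setUP[/hPhi|/hN].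
Qed.

(* The b a with dg a = q lift an F_p-basis of 'L_q / 'Phi('L_q) 'L_q.+1, and the
   phi a are the corresponding coordinates. *)
Record lcs_frame (p : nat) G (I : finType) (dg : I -> nat) (b : I -> gT)
    (phi : I -> gT -> 'F_p) : Prop := LcsFrame {
  frame_pos : forall a, (0 < dg a)%N;
  frame_mem : forall a, b a \in 'L_(dg a)(G);
  frame_additive : forall a, additive_on 'L_(dg a)(G) (phi a);
  frame_lcnS : forall a, {in 'L_(dg a).+1(G), forall x, phi a x = 0%R};
  frame_dual : forall a c, dg a = dg c -> phi a (b c) = (a == c)%:R%R;
  frame_expand : forall q (W : zmodType) (h : gT -> W), (0 < q)%N ->
    (forall w : W, w *+ p = 0)%R ->
    additive_on 'L_q(G) h -> {in 'L_q.+1(G), forall x, h x = 0%R} ->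
    {in 'L_q(G), forall x, h x = \sum_(a | dg a == q) h (b a) *+ phi a x}%R;
  frame_faithful : forall q x, (0 < q)%N -> x \in 'L_q(G) ->
    (forall a, dg a = q -> phi a x = 0%R) -> x \in 'Phi('L_q(G)) <*> 'L_q.+1(G)
}.

Lemma lcs_frame_exists (p : nat) G : prime p -> p.-group G ->
  exists (I : finType) (dg : I -> nat) (b : I -> gT) (phi : I -> gT -> 'F_p),
    lcs_frame G dg b phi.
Proof.
move=> p_pr pG; pose K q := ('Phi('L_q(G)) <*> 'L_q.+1(G))%G.
have pL q : p.-group 'L_q(G) by apply: pgroupS pG; apply: lcn_sub.
have KL q : K q <| 'L_q(G).
  by rewrite normalY ?Phi_normal ?lcn_normalS.
have abLK q : p.-abelem ('L_q(G) / K q).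
  have nKL := normal_norm (KL q).
  have := trivg_Phi (quotient_pgroup (K q) (pL q)); rewrite /= => <-.
  have /= <- := quotient_Phi (pL q) nKL; rewrite -subG1.
  by rewrite quotient_sub1 ?joing_subl // (subset_trans (Phi_sub _)).
pose T := {n : nat & (('I_n -> gT) * ('I_n -> gT -> 'F_p))%type}.
pose ok q (t : T) := let A := 'L_q(G) in let b := (tagged t).1 in
  let phi := (tagged t).2 in
  [/\ forall a, b a \in A,
      forall a, additive_on A (phi a),
      forall a, {in K q, forall x, phi a x = 0%R},
      forall a c, phi a (b c) = (a == c)%:R%R &
      {in A, forall x, exists2 k, k \in K q & x = \prod_a b a ^+ phi a x * k}].
have /all_sig[d dP] q : {t : T | ok q t}.
  apply: cid; have [n [b [phi ok']]] := section_basis p_pr (KL q) (abLK q).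
  by exists (existT _ n (b, phi)).
have /lcnP[M LM1] := pgroup_nil pG.
(* The index [i] stands for weight [i.+1]. Weights above [M] carry no basis vectors, since
   'L_M.+1(G) = 1. *)
pose I := {i : 'I_M & 'I_(tag (d i.+1))}.
pose dg (a : I) := (tag a).+1.
pose b (a : I) := (tagged (d (tag a).+1)).1 (tagged a).
pose phi (a : I) := (tagged (d (tag a).+1)).2 (tagged a).
exists I, dg, b, phi; split=> //.
- by move=> a; case: (dP (tag a).+1) => + _ _ _ _; apply.
- by move=> a; case: (dP (tag a).+1) => _ + _ _ _; apply.
- move=> a x Lx; case: (dP (tag a).+1) => _ _ + _ _; apply.
  by apply: (subsetP (joing_subr _ _)).
- move=> [i u] [j v]; rewrite /dg /= => -[] /val_inj ij; subst j.
  rewrite /phi /b /=; case: (dP i.+1) => _ _ _ -> _; congr (nat_of_bool _)%:R%R.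
  by rewrite -tag_eqE /tag_eq /= eqxx tagged_asE.
- move=> [//|i] W h _ pW hA h0 x Lx; set q := i.+1.
  have [qM|Mq] := ltnP M q.
    have L1 : 'L_q(G) = 1 by apply/trivgP; rewrite -LM1 lcn_sub_leq.
    move: Lx; rewrite L1 => /set1P ->; rewrite (additive_on1 hA) big_pred0 // => a.
    by apply/negbTE; rewrite /dg neq_ltn (leq_ltn_trans (ltn_ord (tag a)) qM).
  case: (dP q) => bL phiA phi0 phib ex; have [k Kk {1}->] := ex x Lx.
  have Lk : k \in 'L_q(G) by apply: subsetP Kk; case/andP: (KL q).
  rewrite hA //; last by apply: group_prod => a _; rewrite groupX.
  rewrite [h k](additive_on_Phi (pL q) pW hA h0) ?lcn_subS // addr0.
  rewrite (additive_on_prod hA) => [|a _]; last by rewrite groupX.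
  pose F (j : 'I_M) (u : 'I_(tag (d j.+1))) :=
    (h ((tagged (d j.+1)).1 u) *+ (tagged (d j.+1)).2 u x)%R.
  rewrite (eq_bigl (fun a : I => ((val (tag a) == i) && true))%N); last first.
    by move=> a; rewrite andbT.
  rewrite -(sig_big_dep (fun j : 'I_M => val j == i) (fun _ _ => true) F).
  rewrite (big_pred1 (Ordinal Mq)) => [|j]; last by rewrite /= -val_eqE.
  by apply: eq_bigr => u _; rewrite (additive_onX hA).
- move=> [//|i] x _ Lx phi0; set q := i.+1.
  have [qM|Mq] := ltnP M q.
    have L1 : 'L_q(G) = 1 by apply/trivgP; rewrite -LM1 lcn_sub_leq.
    by move: Lx; rewrite L1 => /set1P ->; exact: group1.
  case: (dP q) => _ _ _ _ /(_ x Lx)[k Kk ->].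
  rewrite big1 ?mul1g // => u _.
  have := phi0 (Tagged (fun j : 'I_M => 'I_(tag (d j.+1))) (i := Ordinal Mq) u) erefl.
  by rewrite /phi /= => ->.
Qed.

End LowerCentralSections.

(** * The Lie algebra of the lower central series *)

Lemma iter_morphM (G : groupType) (f : G -> G) n :
  {morph f : x y / (x * y)%g} -> {morph iter n f : x y / (x * y)%g}.
Proof. by move=> fM; elim: n => [|n IH] x y //; rewrite !iterS IH fM. Qed.

Section LieAlgebra.
Local Open Scope ring_scope.
Variables (gT : finGroupType) (p : nat).
Hypothesis p_pr : prime p.
Variables (I : finType) (dg : I -> nat) (b : I -> gT) (phi : I -> gT -> 'F_p).
Hypothesis fr : lcs_frame [group of [set: gT]] dg b phi.
Variables (K : fieldType) (iota : {rmorphism 'F_p -> K}).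

Local Notation L q := 'L_q([set: gT])%g.
Local Notation V := {ffun I -> K^o}.

Let pK : p%:R = 0 :> K.
Proof. by rewrite -(rmorph_nat iota) pchar_Fp_0 // rmorph0. Qed.

Let pV (W : lmodType K) (w : W) : w *+ p = 0.
Proof. by rewrite -scaler_nat pK scale0r. Qed.

Implicit Types W : lmodType K.

(** For [x] in [L q], this is the class of [x] in the q-th section, with scalars extended to [K], as
    an element of the direct sum [V]. *)
Definition frame_vec q x : V :=
  [ffun a => if dg a == q then iota (phi a x) else 0].

Definition frame_basis a : V := [ffun c => (c == a)%:R].

Lemma ffun_basis (v : V) : v = \sum_a v a *: frame_basis a.
Proof.
apply/ffunP => c; rewrite sum_ffunE (bigD1 c) //= big1 ?addr0 => [|a ac].
  by rewrite !ffunE eqxx [_ *: _]mulr1.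
by rewrite !ffunE eq_sym (negbTE ac) [_ *: _]mulr0.
Qed.

Definition klinear (W : lmodType K) (h : V -> W) :=
  forall k u v, h (k *: u + v) = k *: h u + h v.

Lemma klinear0 W (h : V -> W) : klinear h -> h 0 = 0.
Proof.
by move=> hl; have := hl 1 0 0; rewrite !scale1r addr0 -{1}[h 0]addr0 => /addrI.
Qed.

Lemma klinear_sum W (h : V -> W) J (r : seq J) (P : pred J) k (F : J -> V) : klinear h ->
  h (\sum_(j <- r | P j) k j *: F j) = \sum_(j <- r | P j) k j *: h (F j).
Proof.
move=> hl; elim: r => [|j r IH]; first by rewrite !big_nil klinear0.
by rewrite !big_cons; case: ifP => // _; rewrite hl IH.
Qed.

Lemma klinear_ext W (h : V -> W) : klinear h -> (forall a, h (frame_basis a) = 0) ->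
  forall v, h v = 0.
Proof.
move=> hl h0 v; rewrite (ffun_basis v) klinear_sum // big1 // => a _.
by rewrite h0 scaler0.
Qed.

Lemma klinear_comp W (h : V -> W) (h' : V -> V) :
  klinear h -> klinear h' -> klinear (fun v => h (h' v)).
Proof. by move=> hl hl' k u v; rewrite hl' hl. Qed.

Lemma klinearB W (h h' : V -> W) :
  klinear h -> klinear h' -> klinear (fun v => h v - h' v).
Proof.
by move=> hl hl' k u v; rewrite hl hl' scalerBr opprD addrACA.
Qed.

Lemma frame_vec_additive q : additive_on (L q) (frame_vec q).
Proof.
move=> x y Lx Ly; apply/ffunP => a; rewrite !ffunE; case: eqP => [dq|_]; last first.
  by rewrite addr0.
by rewrite -rmorphD (frame_additive fr) ?dq.
Qed.

Lemma frame_vec_lcnS q : {in L q.+1, forall x, frame_vec q x = 0}.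
Proof.
move=> x Lx; apply/ffunP => a; rewrite !ffunE; case: eqP => // dq.
by rewrite (frame_lcnS fr) ?rmorph0 ?dq.
Qed.

Lemma frame_basis_frame_vec a : frame_basis a = frame_vec (dg a) (b a).
Proof.
apply/ffunP => c; rewrite !ffunE; case: (dg c =P dg a) => [dca|nd].
  by rewrite (frame_dual fr) //; case: (c == a); rewrite ?rmorph1 ?rmorph0.
by case: eqP => // ca; case: nd; rewrite ca.
Qed.

(** The universal property of a section: a map additive on [L q] and trivial on [L q.+1] extends
    linearly to [V]. The target has characteristic [p], so it kills the Frattini part too. *)
Lemma frame_lin q (W : lmodType K) (h : gT -> W) : (0 < q)%N ->
  additive_on (L q) h -> {in L q.+1, forall x, h x = 0} ->
  {in L q, forall x, h x = \sum_a frame_vec q x a *: h (b a)}.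
Proof.
move=> q0 hA h0 x Lx; rewrite (frame_expand fr q0 _ hA h0 Lx); last exact: pV.
rewrite [RHS](bigID (fun a => dg a == q)) /= [X in _ + X]big1 ?addr0.
  apply: eq_bigr => a /eqP dq; rewrite ffunE dq eqxx -scaler_nat.
  by rewrite -(rmorph_nat iota) natr_Zp.
by move=> a /negbTE dq; rewrite ffunE dq scale0r.
Qed.

(** The bilinear extension of the group commutator on the chosen lifts; [frame_bracket_vec] shows
    that it is independent of the lifts. *)
Definition frame_bracket (u v : V) : V :=
  \sum_a \sum_c (u a * v c) *: frame_vec (dg a + dg c)%N [~ b a, b c]%g.

Lemma frame_bracket_linl v : klinear (frame_bracket^~ v).
Proof.
move=> k u u'; rewrite /frame_bracket scaler_sumr -big_split; apply: eq_bigr => a _ /=.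
rewrite scaler_sumr -big_split; apply: eq_bigr => c _ /=.
by rewrite !ffunE mulrDl scalerDl scalerA mulrA.
Qed.

Lemma frame_bracket_linr u : klinear (frame_bracket u).
Proof.
move=> k v v'; rewrite /frame_bracket scaler_sumr -big_split; apply: eq_bigr => a _ /=.
rewrite scaler_sumr -big_split; apply: eq_bigr => c _ /=.
by rewrite !ffunE mulrDr scalerDl scalerA mulrCA.
Qed.

Lemma mem_comm_lcn i j x y : (0 < i)%N -> (0 < j)%N -> x \in L i -> y \in L j ->
  [~ x, y]%g \in L (i + j)%N.
Proof.
case: i j => // i [//|j] _ _ Lx Ly; rewrite addnS addSn.
by apply: (subsetP (comm_lcn [group of [set: gT]] i j)); apply: mem_commg.
Qed.

Lemma mem_lcnS q x : x \in L q.+1 -> x \in L q.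
Proof. exact: (subsetP (lcn_subS q [group of [set: gT]])). Qed.

Let LM q x y : x \in L q -> y \in L q -> (x * y)%g \in L q.
Proof. by move=> Lx Ly; rewrite (groupM (G := [group of L q])). Qed.

Let LV q x : x \in L q -> (x^-1)%g \in L q.
Proof. by move=> Lx; rewrite (groupVr (G := [group of L q])). Qed.

(** In [xx',y] = [x,y][x,y,x'][x',y] the middle factor lies one term deeper and is invisible in the
    section. *)
Lemma frame_vec_comm_additivel i j y : (0 < i)%N -> (0 < j)%N -> y \in L j ->
  additive_on (L i) (fun x => frame_vec (i + j)%N [~ x, y]%g).
Proof.
move=> i0 j0 Ly x x' Lx Lx'; rewrite commMgR.
have Lxy := mem_comm_lcn i0 j0 Lx Ly.
have Lxyx : [~ x, y, x']%g \in L (i + j).+1%N.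
  apply: (subsetP (lcn_sub_leq _ _)) (mem_comm_lcn _ i0 Lxy Lx'); lia.
have Lx'y := mem_comm_lcn i0 j0 Lx' Ly.
rewrite (frame_vec_additive (LM Lxy (mem_lcnS Lxyx)) Lx'y).
rewrite (frame_vec_additive Lxy (mem_lcnS Lxyx)).
by rewrite (frame_vec_lcnS Lxyx) addr0.
Qed.

Lemma frame_vec_comm_additiver i j x : (0 < i)%N -> (0 < j)%N -> x \in L i ->
  additive_on (L j) (fun y => frame_vec (i + j)%N [~ x, y]%g).
Proof.
move=> i0 j0 Lx y y' Ly Ly'; rewrite commgMR.
have Lxy := mem_comm_lcn i0 j0 Lx Ly.
have Lxyy : [~ x, y, y']%g \in L (i + j).+1%N.
  apply: (subsetP (lcn_sub_leq _ _)) (mem_comm_lcn _ j0 Lxy Ly'); lia.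
have Lxy' := mem_comm_lcn i0 j0 Lx Ly'.
rewrite (frame_vec_additive (LM Lxy' Lxy) (mem_lcnS Lxyy)) (frame_vec_additive Lxy' Lxy).
by rewrite (frame_vec_lcnS Lxyy) addr0 addrC.
Qed.

Lemma frame_bracket_vec i j x y : (0 < i)%N -> (0 < j)%N -> x \in L i -> y \in L j ->
  frame_bracket (frame_vec i x) (frame_vec j y) = frame_vec (i + j)%N [~ x, y]%g.
Proof.
move=> i0 j0 Lx Ly.
rewrite (frame_lin (h := fun x => frame_vec (i + j)%N [~ x, y]%g) i0
  (frame_vec_comm_additivel i0 j0 Ly)) //; last first.
  by move=> z Lz; apply: frame_vec_lcnS; rewrite -addSn mem_comm_lcn.
apply: eq_bigr => a _; rewrite [frame_vec i x a]ffunE; case: eqP => [da|_]; last first.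
  by rewrite scale0r big1 // => c _; rewrite mul0r scale0r.
have Lb : b a \in L i by rewrite -da; exact: (frame_mem fr).
rewrite (frame_lin (h := fun y => frame_vec (i + j)%N [~ b a, y]%g) j0
  (frame_vec_comm_additiver i0 j0 Lb)) //; last first.
  by move=> z Lz; apply: frame_vec_lcnS; rewrite -addnS mem_comm_lcn.
rewrite scaler_sumr; apply: eq_bigr => c _; rewrite scalerA.
rewrite [frame_vec j y c]ffunE; case: eqP => [dc|_]; last by rewrite mulr0 !scale0r.
by rewrite da dc.
Qed.

Lemma frame_vec_commC i j x y : (0 < i)%N -> (0 < j)%N -> x \in L i -> y \in L j ->
  frame_vec (i + j)%N [~ x, y]%g = - frame_vec (j + i)%N [~ y, x]%g.
Proof.
move=> i0 j0 Lx Ly; rewrite -(invg_comm y x) addnC.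
by rewrite (additive_onV (@frame_vec_additive _)) // mem_comm_lcn.
Qed.

Lemma frame_vec_jacobi i j k x y z : (0 < i)%N -> (0 < j)%N -> (0 < k)%N ->
  x \in L i -> y \in L j -> z \in L k ->
  frame_vec (i + j + k)%N [~ x, y, z]%g + frame_vec (j + k + i)%N [~ y, z, x]%g
    + frame_vec (k + i + j)%N [~ z, x, y]%g = 0.
Proof.
move=> i0 j0 k0 Lx Ly Lz.
(* The Hall-Witt identity has inverted middle entries and conjugations. Modulo the next term
   conjugation disappears, and by bilinearity the inverse becomes a sign. *)
have key l m n u v w : (0 < l)%N -> (0 < m)%N -> (0 < n)%N ->
    u \in L l -> v \in L m -> w \in L n ->
    frame_vec (l + m + n)%N ([~ u, v^-1, w] ^ v)%g = - frame_vec (l + m + n)%N [~ u, v, w]%g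
    /\ ([~ u, v^-1, w] ^ v)%g \in L (l + m + n)%N.
  move=> l0 m0 n0 Lu Lv Lw.
  have lm0 : (0 < l + m)%N by rewrite addn_gt0 l0.
  have Luv := mem_comm_lcn l0 m0 Lu (LV Lv).
  have Luvw := mem_comm_lcn lm0 n0 Luv Lw.
  have Lc : [~ [~ u, v^-1, w], v]%g \in L (l + m + n).+1%N.
    apply: (subsetP (lcn_sub_leq _ _)) (mem_comm_lcn _ m0 Luvw Lv); lia.
  rewrite conjg_mulR LM //; last exact: mem_lcnS.
  split=> //; rewrite frame_vec_additive // ?(mem_lcnS Lc) // (frame_vec_lcnS Lc) addr0.
  rewrite -frame_bracket_vec // -(frame_bracket_vec l0 m0 Lu (LV Lv)).
  rewrite (additive_onV (@frame_vec_additive _)) // -[LHS]addr0.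
  have -> : - frame_vec m v = (-1) *: frame_vec m v + 0 by rewrite scaleN1r addr0.
  rewrite frame_bracket_linr (klinear0 (frame_bracket_linr _)).
  rewrite frame_bracket_linl (klinear0 (frame_bracket_linl _)).
  by rewrite !addr0 scaleN1r !frame_bracket_vec // mem_comm_lcn.
have [e1 m1] := key _ _ _ _ _ _ i0 j0 k0 Lx Ly Lz.
have [e2 m2] := key _ _ _ _ _ _ j0 k0 i0 Ly Lz Lx.
have [e3 m3] := key _ _ _ _ _ _ k0 i0 j0 Lz Lx Ly.
have e : (j + k + i = i + j + k)%N /\ (k + i + j = i + j + k)%N by lia.
rewrite (proj1 e) in e2 m2 *; rewrite (proj2 e) in e3 m3 *.
have := congr1 (frame_vec (i + j + k)%N) (Hall_Witt_identity x y z).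
rewrite (frame_vec_additive (LM m1 m2) m3) (frame_vec_additive m1 m2).
rewrite (additive_on1 (@frame_vec_additive (i + j + k)%N)) e1 e2 e3.
rewrite ?(proj1 e) ?(proj2 e).
by rewrite -!opprD => /eqP; rewrite oppr_eq0 => /eqP.
Qed.

(** By trilinearity it suffices to treat basis vectors, where this is the Jacobi identity rearranged
    by antisymmetry. *)
Lemma frame_bracket_leibniz u v w :
  frame_bracket u (frame_bracket v w) =
  frame_bracket (frame_bracket u v) w - frame_bracket (frame_bracket u w) v.
Proof.
apply/eqP; rewrite -subr_eq0; apply/eqP.
move: u; apply: klinear_ext => [|a].
  apply: klinearB; first exact: frame_bracket_linl.
  by apply: klinearB; apply: (klinear_comp (frame_bracket_linl _)); apply: frame_bracket_linl.
move: v; apply: klinear_ext => [|c].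
  apply: klinearB; first by apply: (klinear_comp (frame_bracket_linr _)); apply: frame_bracket_linl.
  apply: klinearB; last exact: frame_bracket_linr.
  by apply: (klinear_comp (frame_bracket_linl _)); apply: frame_bracket_linr.
move: w; apply: klinear_ext => [|d].
  apply: klinearB; first by apply: (klinear_comp (frame_bracket_linr _)); apply: frame_bracket_linr.
  apply: klinearB; first exact: frame_bracket_linr.
  by apply: (klinear_comp (frame_bracket_linl _)); apply: frame_bracket_linr.
rewrite !frame_basis_frame_vec.
have da := frame_pos fr a; have dc := frame_pos fr c; have dd := frame_pos fr d.
have ma := frame_mem fr a; have mc := frame_mem fr c; have md := frame_mem fr d.
have pos i j : (0 < i)%N -> (0 < i + j)%N by move=> i0; rewrite addn_gt0 i0.
have mcd := mem_comm_lcn dc dd mc md; have mad := mem_comm_lcn da dd ma md.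
have mda := mem_comm_lcn dd da md ma.
have := frame_vec_jacobi da dc dd ma mc md.
rewrite !frame_bracket_vec ?pos ?mem_comm_lcn //.
rewrite (frame_vec_commC _ _ mcd ma) ?pos //.
have -> : frame_vec (dg d + dg a + dg c)%N [~ b d, b a, b c]%g =
   - frame_vec (dg a + dg d + dg c)%N [~ b a, b d, b c]%g.
  rewrite -(frame_bracket_vec _ dc mda mc) ?pos // frame_vec_commC // -scaleN1r -[_ *: _]addr0.
  rewrite frame_bracket_linl (klinear0 (frame_bracket_linl _)) addr0 scaleN1r.
  by rewrite (frame_bracket_vec _ dc mad mc) ?pos.
by move=> e0; rewrite -[RHS]oppr0 -e0 !opprB addrCA.
Qed.

Definition frame_map (f : gT -> gT) (v : V) : V :=
  \sum_a v a *: frame_vec (dg a) (f (b a)).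

Lemma frame_map_lin f : klinear (frame_map f).
Proof.
move=> k u v; rewrite /frame_map scaler_sumr -big_split; apply: eq_bigr => a _ /=.
by rewrite !ffunE scalerDl scalerA.
Qed.

Lemma morph_lcn (f : gT -> gT) q x : {morph f : x y / (x * y)%g} ->
  x \in L q -> f x \in L q.
Proof.
move=> fM Lx; pose fm := Morphism (D := [set: gT]) (in2W fM).
have : fm x \in (fm @* L q)%g by apply: mem_morphim; rewrite ?inE.
by rewrite morphim_lcn //; apply/subsetP/lcnS/subsetT.
Qed.

Lemma frame_map_vec f q x : {morph f : x y / (x * y)%g} -> (0 < q)%N -> x \in L q ->
  frame_map f (frame_vec q x) = frame_vec q (f x).
Proof.
move=> fM q0 Lx; rewrite (frame_lin (h := fun x => frame_vec q (f x)) q0 _ _ Lx).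
- apply: eq_bigr => a _; rewrite [frame_vec q x a]ffunE; case: eqP => [->//|_].
  by rewrite !scale0r.
- by move=> y z Ly Lz; rewrite fM frame_vec_additive // morph_lcn.
- by move=> y Ly; apply: frame_vec_lcnS; apply: morph_lcn.
Qed.

Lemma frame_map_basis f a : {morph f : x y / (x * y)%g} ->
  frame_map f (frame_basis a) = frame_vec (dg a) (f (b a)).
Proof.
move=> fM; rewrite frame_basis_frame_vec frame_map_vec //.
  exact: (frame_pos fr).
exact: (frame_mem fr).
Qed.

Lemma frame_map_br f u v : {morph f : x y / (x * y)%g} ->
  frame_map f (frame_bracket u v) = frame_bracket (frame_map f u) (frame_map f v).
Proof.
move=> fM; apply/eqP; rewrite -subr_eq0; apply/eqP.
move: u; apply: klinear_ext => [|a].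
  apply: klinearB; first by apply: (klinear_comp (frame_map_lin _)); apply: frame_bracket_linl.
  by apply: (klinear_comp (frame_bracket_linl _)); apply: frame_map_lin.
move: v; apply: klinear_ext => [|c].
  apply: klinearB; first by apply: (klinear_comp (frame_map_lin _)); apply: frame_bracket_linr.
  by apply: (klinear_comp (frame_bracket_linr _)); apply: frame_map_lin.
have da := frame_pos fr a; have dc := frame_pos fr c.
have ma := frame_mem fr a; have mc := frame_mem fr c.
rewrite !frame_map_basis // !frame_basis_frame_vec !frame_bracket_vec ?morph_lcn //.
rewrite frame_map_vec //.
- by rewrite !commgEl /conjg !fM -!(morphV (Morphism (D := [set: gT]) (in2W fM))) ?inE // subrr.
- by rewrite addn_gt0 da.
- exact: mem_comm_lcn.
Qed.

Lemma frame_map_comp f g v : {morph f : x y / (x * y)%g} -> {morph g : x y / (x * y)%g} ->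
  frame_map f (frame_map g v) = frame_map (f \o g) v.
Proof.
move=> fM gM; have fgM : {morph f \o g : x y / (x * y)%g} by move=> x y; rewrite /= gM fM.
apply/eqP; rewrite -subr_eq0; apply/eqP; move: v; apply: klinear_ext => [|a].
  by apply: klinearB; [apply: (klinear_comp (frame_map_lin _)) |]; apply: frame_map_lin.
rewrite !frame_map_basis // frame_map_vec ?subrr //; first exact: (frame_pos fr).
by apply: morph_lcn => //; exact: (frame_mem fr).
Qed.

Lemma frame_map_id f v : f =1 id -> frame_map f v = v.
Proof.
move=> fid; rewrite [RHS](ffun_basis v); apply: eq_bigr => a _.
by rewrite fid frame_basis_frame_vec.
Qed.

Lemma frame_map_iter f n v : {morph f : x y / (x * y)%g} ->
  frame_map (iter n f) v = iter n (frame_map f) v.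
Proof.
move=> fM; elim: n => [|n IH]; first exact: frame_map_id.
by rewrite iterS -IH (frame_map_comp _ fM (iter_morphM n fM)).
Qed.

End LieAlgebra.

(** * Eigenvectors *)

Section Eigenvectors.
Local Open Scope ring_scope.
Variables (K : closedFieldType) (W : lmodType K) (T : W -> W).
Hypothesis Tlin : forall k u v, T (k *: u + v) = k *: T u + T v.

Let T0 : T 0 = 0.
Proof. by have := Tlin 1 0 0; rewrite !scale1r addr0 -{1}[T 0]addr0 => /addrI. Qed.

Let TZ k u : T (k *: u) = k *: T u.
Proof. by have := Tlin k u 0; rewrite T0 !addr0. Qed.

Let TD u v : T (u + v) = T u + T v.
Proof. by have := Tlin 1 u v; rewrite !scale1r. Qed.

Let Tsum J (r : seq J) (P : pred J) (F : J -> W) :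
  T (\sum_(j <- r | P j) F j) = \sum_(j <- r | P j) T (F j).
Proof. exact: (big_morph T TD T0). Qed.

Let iterTZ n k u : iter n T (k *: u) = k *: iter n T u.
Proof. by elim: n => //= n ->; rewrite TZ. Qed.

Let iterTD n u v : iter n T (u + v) = iter n T u + iter n T v.
Proof. by elim: n => //= n ->; rewrite TD. Qed.

(** Applying the operators T - z in turn evaluates the product of the X - z at [T]. *)
Lemma foldr_prod_XsubC (rs : seq K) v :
  foldr (fun z u => T u - z *: u) v rs =
  \sum_(k < (size rs).+1) (\prod_(z <- rs) ('X - z%:P))`_k *: iter k T v.
Proof.
elim: rs => [|z rs IH] /=.
  by rewrite big_ord1 big_nil coefC eqxx scale1r.
rewrite IH big_cons; set Q := \prod_(_ <- rs) _.
have szQ : size Q = (size rs).+1 by rewrite size_prod_XsubC.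
rewrite Tsum scaler_sumr.
under [RHS]eq_bigr do rewrite mulrBl coefB coefXM coefCM scalerBl.
rewrite [RHS]big_split /= sumrN [X in _ = X - _]big_ord_recl /= scale0r add0r.
rewrite [X in _ = _ - X]big_ord_recr /= (nth_default 0) ?szQ // mulr0 scale0r addr0.
congr (_ - _); apply: eq_bigr => k _; first by rewrite TZ.
by rewrite scalerA.
Qed.

(** The polynomial X^n - c splits, and the product of its linear factors at [T] kills [v]. The last
    nonzero vector obtained while applying the factors one by one is an eigenvector of [T]. *)
Lemma eigen_of_power n c v : (0 < n)%N -> v != 0 -> iter n T v = c *: v ->
  exists l w, [/\ w != 0, T w = l *: w & l ^+ n = c].
Proof.
move=> n0 v0 Tv; have [rs] := closed_field_poly_normal ('X^n - c%:P : {poly K}).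
rewrite (eqP (monicXnsubC c n0)) scale1r => PE.
have szrs : size rs = n.
  by have := congr1 (size \o val) PE; rewrite /= size_XnsubC // size_prod_XsubC => -[].
have := foldr_prod_XsubC rs v; rewrite -PE szrs.
rewrite big_ord_recr /= coefB coefXn coefC eqxx gtn_eqF // subr0 scale1r Tv.
case: n n0 Tv PE szrs => // n _ Tv PE szrs.
rewrite big_ord_recl /= coefB coefXn coefC /= sub0r.
rewrite big1 => [|i _]; last first.
  by rewrite coefB coefXn coefC /= ltn_eqF ?ltnS //= subr0 scale0r.
rewrite addr0 scaleNr addNr => f0.
suff [l lrs [w [w0 Tw]]] : exists2 l, l \in rs & exists w, w != 0 /\ T w = l *: w.
  exists l, w; split=> //; apply/eqP; rewrite -subr_eq0.
  have : root ('X^(n.+1) - c%:P) l by rewrite PE root_prod_XsubC.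
  by rewrite /root !hornerE.
elim: rs {PE szrs} f0 => [/= v00|z rs IH] /=; first by rewrite v00 eqxx in v0.
set u := foldr _ _ _; have [u00 _|u0 /eqP] := eqVneq u 0.
  by have [l lrs w] := IH u00; exists l; rewrite // inE lrs orbT.
by rewrite subr_eq0 => /eqP Tu; exists z; [rewrite inE eqxx | exists u].
Qed.

Lemma prim_root_exists s : (s%:R != 0 :> K) -> (0 < s)%N ->
  exists z : K, s.-primitive_root z.
Proof.
move=> sK s_gt0; have [r] := closed_field_poly_normal ('X^s - 1 : {poly K}).
rewrite (eqP (monic_Xn_sub_1 _ s_gt0)) scale1r => Dp.
have rn1 : all s.-unity_root r by apply/allP => z; rewrite -root_prod_XsubC -Dp.
have sz_r : (size r >= s)%N by rewrite -ltnS -(size_prod_XsubC r id) -Dp size_Xn_sub_1.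
have [|z] := hasP (has_prim_root s_gt0 rn1 _ sz_r); last by exists z.
by rewrite -separable_prod_XsubC -Dp separable_Xn_sub_1.
Qed.

Lemma power_eigen_decomposition n s (z : K) : (0 < s)%N -> (s%:R != 0 :> K) ->
  s.-primitive_root z -> (forall v, iter s (iter n T) v = v) ->
  forall v, exists F : 'I_s -> W,
    (forall i, iter n T (F i) = z ^+ i *: F i) /\ v = \sum_i F i.
Proof.
move=> s0 sK prz gs v; set g := iter n T in gs *.
have z0 : z != 0 by rewrite (prim_root_eq0 prz) -lt0n.
have gZ k u : g (k *: u) = k *: g u by exact: iterTZ.
have gD u w : g (u + w) = g u + g w by exact: iterTD.
have gsum J (r : seq J) (F : J -> W) : g (\sum_(j <- r) F j) = \sum_(j <- r) g (F j).
  by apply: (big_morph g gD); have := gZ 0 0; rewrite !scale0r.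
(* The discrete Fourier transform of the orbit of [v] under [g]; it recovers [v] by orthogonality of
   the powers of [z]. *)
exists (fun i => s%:R^-1 *: \sum_(j < s) (z ^+ i)^-1 ^+ j *: iter j g v).
split=> [i|].
  rewrite gZ scalerA mulrC -scalerA; congr (_ *: _); rewrite gsum.
  set c := z ^+ i; have c0 : c != 0 by rewrite expf_neq0.
  pose H j := c *: (c^-1 ^+ j *: iter j g v).
  (* Applying [g] shifts the sum by one place, and the sum is cyclic because both [g] and [z] have
     s-th power 1. *)
  have HS : H s = H 0.
    by rewrite /H gs exprVn -exprM mulnC exprM (prim_expr_order prz) expr1n invr1 !scale1r.
  rewrite scaler_sumr -/(H _) (eq_bigr (fun j : 'I_s => H j.+1)); last first.
    by move=> j _; rewrite /H gZ scalerA exprS mulrA divff // mul1r.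
  have := big_ord_recl s (fun j => H (val j)) (idx := 0) (op := +%R).
  rewrite big_ord_recr /= HS addrC => /addrI E.
  exact/esym.
under eq_bigr do rewrite scaler_sumr.
rewrite exchange_big /=.
case: s s0 sK prz gs => // s _ sK prz gs.
rewrite big_ord_recl [X in _ + X]big1 ?addr0 => [|j _].
  under eq_bigr do rewrite expr0 scale1r.
  by rewrite sumr_const card_ord -scaler_nat scalerA divff // scale1r.
under eq_bigr do rewrite exprVn -exprM mulnC exprM -exprVn scalerA.
rewrite -scaler_suml -mulr_sumr.
set c := (z ^+ _)^-1.
suff -> : \sum_(i < s.+1) c ^+ i = 0 by rewrite mulr0 scale0r.
have c1 : c - 1 != 0.
  rewrite subr_eq0 /c invr_eq1 -(expr0 z) (eq_prim_root_expr prz) mod0n.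
  by rewrite modn_small // ltnS.
apply: (mulfI c1); rewrite -subrX1 mulr0 /c exprVn -exprM mulnC exprM.
by rewrite (prim_expr_order prz) expr1n invr1 subrr.
Qed.

End Eigenvectors.

Section LaurentRoots.
Local Open Scope ring_scope.

(** Dividing by the lowest power of z leaves a polynomial of degree at most the degree of the
    identity; the point [z0] certifies that it is nonzero. *)
Lemma laurent_roots_le (F K : fieldType) (iota : {rmorphism F -> K}) k
    (m n : 'I_k -> int) (rs : seq K) (z0 : K) :
  z0 != 0 -> laurent_value iota m n z0 != 0 ->
  uniq rs -> (forall z, z \in rs -> z != 0 /\ laurent_value iota m n z = 0) ->
  (size rs <= identity_degree m)%N.
Proof.
move=> z0n vz0 urs rsP.
case: k => [|k] in m n vz0 rsP *; first by rewrite /laurent_value big_ord0 eqxx in vz0.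
pose t0 := [arg min_(t < ord0) m t]%O.
have t0P t : m t0 <= m t by rewrite /t0; case: Order.TotalTheory.arg_minP => // i _; apply.
pose d t := `|m t - m t0|%N.
have dE t : m t = m t0 + (d t)%:Z by rewrite /d gez0_abs ?subr_ge0 // [RHS]addrC subrK.
pose P : {poly K} := \sum_t (iota (n t)%:~R) *: 'X^(d t).
have PE z : z != 0 -> laurent_value iota m n z = z ^ m t0 * P.[z].
  move=> zn; rewrite /laurent_value horner_sum mulr_sumr; apply: eq_bigr => t _.
  by rewrite hornerZ hornerXn dE expfzDr // -exprnP mulrCA.
have Pn0 : P != 0.
  by apply: contraNneq vz0 => P0; rewrite PE // P0 horner0 mulr0.
have szP : (size P <= (identity_degree m).+1)%N.
  apply: (leq_trans (size_sum _ _ _)); apply/bigmax_leqP => t _.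
  apply: (leq_trans (size_scale_leq _ _)); rewrite size_polyXn ltnS.
  apply: leq_trans (leq_bigmax t); exact: (leq_bigmax t0).
rewrite -ltnS; apply: leq_trans szP; apply: max_poly_roots => //.
apply/allP => z /rsP[zn]; rewrite PE // => /eqP; rewrite mulf_eq0 => /orP[|//].
by rewrite expfz_eq0 (negbTE zn) andbF.
Qed.

End LaurentRoots.

(** * The nilpotency class *)

Lemma aut_finite_order (gT : finGroupType) (f : automorphism gT) :
  exists2 N, 0 < N & iter N f =1 id.
Proof.
pose s := perm (can_inj (aut_funK f)); exists #[s]%g; first exact: order_gt0.
move=> x; have := permX s x #[s]%g; rewrite expg_order perm1 => {2}->.
by apply: eq_iter => y; rewrite permE.
Qed.

Lemma autz_morph (gT : groupType) (f : automorphism gT) j :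
  {morph autz f j : x y / (x * y)%g}.
Proof.
case: j => n; apply: iter_morphM; first exact: gmulfM.
exact: can2_gmulfM (aut_funK f) (aut_invK f).
Qed.

Section ClassBound.
Local Open Scope ring_scope.
Variables (p : nat) (p_pr : prime p) (K : closedFieldType).
Variable iota : {rmorphism 'F_p -> K}.
Variables (gT : finGroupType) (f : automorphism gT).
Hypothesis pG : (p.-group [set: gT])%g.
Variables (k : nat) (ms ns : 'I_k -> int).
Hypothesis f_id : satisfies_identity f ms ns.
Hypothesis f_af : identity_arithmetically_free iota ms ns.

Variables (I : finType) (dg : I -> nat) (b : I -> gT) (phi : I -> gT -> 'F_p).
Hypothesis fr : lcs_frame [group of [set: gT]] dg b phi.

Local Notation L q := 'L_q([set: gT])%g.
Local Notation V := {ffun I -> K^o}.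
Local Notation emb := (frame_vec dg phi iota).
Local Notation br := (frame_bracket dg b phi iota).
Local Notation hat := (frame_map dg b phi iota).
Local Notation T := (hat f).

Let fM : {morph f : x y / (x * y)%g}. Proof. exact: gmulfM. Qed.

Let pcharK : p \in [pchar K].
Proof. by rewrite inE p_pr -(rmorph_nat iota) pchar_Fp_0 // rmorph0 /=. Qed.

Lemma frame_map_inj v : T v = 0 -> v = 0.
Proof.
have [N N0 fN] := aut_finite_order f => Tv.
have := frame_map_iter p_pr fr iota N v fM; rewrite (frame_map_id fr iota _ fN) => ->.
case: N N0 {fN} => // N _; rewrite iterSr Tv; elim: N => //= N ->.
exact: (klinear0 (frame_map_lin dg b phi iota f)).
Qed.

Lemma frame_map_autz_eigen j l w : w != 0 -> T w = l *: w ->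
  hat (autz f j) w = l ^ j *: w.
Proof.
move=> w0 Tw; have l0 : l != 0.
  by apply: contraNneq w0 => l0; apply/eqP/frame_map_inj; rewrite Tw l0 scale0r.
have hZ g c u : hat g (c *: u) = c *: hat g u.
  have := frame_map_lin dg b phi iota g c u 0.
  by rewrite !addr0 (klinear0 (frame_map_lin _ _ _ _ g)) addr0.
case: j => n.
  rewrite /= (frame_map_iter p_pr fr) //; elim: n => [|n IH]; first by rewrite scale1r.
  by rewrite iterS IH hZ Tw scalerA -!exprnP exprSr.
have invM : {morph aut_inv f : x y / (x * y)%g}.
  exact: can2_gmulfM (aut_funK f) (aut_invK f).
have Tinv : hat (aut_inv f) w = l^-1 *: w.
  apply: (scalerI l0); rewrite scalerA divff // scale1r -hZ -Tw.
  rewrite (frame_map_comp p_pr fr) // (frame_map_id fr) // => x /=; exact: aut_funK.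
rewrite [LHS](frame_map_iter p_pr fr iota n.+1 w invM) NegzE -exprnN.
elim: n.+1 => [|i IH]; first by rewrite expr0 invr1 scale1r.
by rewrite iterS IH hZ Tinv scalerA exprS invfM mulrC.
Qed.

(** Read in an abelian section, the identity becomes linear: its instances at the lifts [b a] say
    that the Laurent polynomial vanishes at [T]. *)
Lemma frame_map_identity v : \sum_(t < k) (iota (ns t)%:~R) *: hat (autz f (ms t)) v = 0.
Proof.
move: v; apply: klinear_ext => [c u v|a].
  rewrite scaler_sumr -big_split; apply: eq_bigr => t _ /=.
  by rewrite frame_map_lin scalerDr !scalerA mulrC.
have bL := frame_mem fr a.
pose g t := autz f (ms t) (expgz (b a) (ns t)).
have gL t : g t \in L (dg a).
  apply: morph_lcn; first exact: autz_morph.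
  rewrite /expgz; case: (ns t) => n; first by rewrite (groupX (G := [group of L (dg a)])).
  by rewrite (groupVr (G := [group of L (dg a)])) // (groupX (G := [group of L (dg a)])).
have eA := frame_vec_additive fr iota (q := dg a).
have := congr1 (emb (dg a)) (f_id (b a)).
rewrite (additive_on1 eA) (additive_on_prod eA) => [E|t _]; last exact: gL.
rewrite [RHS]E; apply: eq_bigr => t _.
rewrite (frame_map_basis p_pr fr); last exact: autz_morph.
have hA : additive_on (L (dg a)) (fun x => emb (dg a) (autz f (ms t) x)).
  by move=> x y Lx Ly; rewrite autz_morph eA // morph_lcn //; apply: autz_morph.
rewrite /expgz; case: (ns t) => n.
  by rewrite (additive_onX hA) // -pmulrn rmorph_nat scaler_nat.
rewrite (additive_onV hA) ?(groupX (G := [group of L (dg a)])) // (additive_onX hA) //.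
by rewrite NegzE mulrNz rmorphN -pmulrn rmorph_nat scaleNr scaler_nat.
Qed.

Lemma eigenvalue_laurent_root l w : w != 0 -> T w = l *: w ->
  l != 0 /\ laurent_value iota ms ns l = 0.
Proof.
move=> w0 Tw; split.
  by apply: contraNneq w0 => l0; apply/eqP/frame_map_inj; rewrite Tw l0 scale0r.
have := frame_map_identity w.
under eq_bigr do rewrite (frame_map_autz_eigen _ w0 Tw) scalerA.
rewrite -scaler_suml => /eqP; rewrite scaler_eq0 (negbTE w0) orbF => /eqP; exact.
Qed.

(** Otherwise 1 would be a root, and its trivial coset would violate arithmetic freeness. *)
Lemma laurent_nonzero : exists2 z : K, z != 0 & laurent_value iota ms ns z != 0.
Proof.
apply: contrapT => nz; case: f_af => _ []; exists 1%g, 1%g.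
have all0 (z : unit_group K) : laurent_roots iota ms ns z.
  apply/eqP; apply: contrapT => /negP vz; apply: nz; exists (unit_val z) => //.
  exact: unit_valP.
by split=> // z _; apply: all0.
Qed.

(** * The grading by eigenspaces of the p^e-th power of the automorphism *)

Section Grading.
Variables (e s : nat) (z : K).
Hypothesis prz : s.+1.-primitive_root z.
Hypothesis sK : s.+1%:R != 0 :> K.
Hypothesis Ts : forall v, iter s.+1 (iter (p ^ e) T) v = v.

Definition eigen_family : 'I_s.+1 -> V -> Prop := fun i v =>
  iter (p ^ e) T v = z ^+ i *: v.

Definition eigen_support : {set 'I_s.+1} := [set i | `[< exists2 v, eigen_family i v & v != 0 >]].

Let pe0 : (0 < p ^ e)%N. Proof. by rewrite expn_gt0 prime_gt0. Qed.

Lemma iter_hat_lin n : klinear (iter n T).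
Proof. by elim: n => // n IH c u v; rewrite !iterS IH frame_map_lin. Qed.

Lemma iter_frame_map_br n u v : iter n T (br u v) = br (iter n T u) (iter n T v).
Proof. by elim: n => // n IH; rewrite !iterS IH (frame_map_br p_pr fr). Qed.

Lemma klinear_sub (h : V -> V) u v : klinear h -> h (u - v) = h u - h v.
Proof.
by move=> hl; rewrite addrC -scaleN1r hl scaleN1r addrC.
Qed.

Lemma klinear_scale (h : V -> V) c u : klinear h -> h (c *: u) = c *: h u.
Proof. by move=> hl; rewrite -[c *: u]addr0 hl (klinear0 hl) addr0. Qed.

Lemma frame_bracketBl x y u : br (x - y) u = br x u - br y u.
Proof. exact: (klinear_sub _ _ (frame_bracket_linl _ _ _ _ _)). Qed.

Lemma frame_bracketBr u x y : br u (x - y) = br u x - br u y.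
Proof. exact: (klinear_sub _ _ (frame_bracket_linr _ _ _ _ _)). Qed.

Lemma eigen_family_subalgebra : graded_subalgebra br eigen_family.
Proof.
have zf : zfamily eigen_family.
  move=> i; split; first by rewrite /eigen_family (klinear0 (iter_hat_lin _)) scaler0.
  by move=> u v cu cv; rewrite /eigen_family (klinear_sub _ _ (iter_hat_lin _)) cu cv scalerBr.
split=> //; apply: homprod_sub => // i j u v cu cv.
rewrite /eigen_family iter_frame_map_br cu cv (klinear_scale _ _ (frame_bracket_linl _ _ _ _ _)).
by rewrite (klinear_scale _ _ (frame_bracket_linr _ _ _ _ _)) scalerA -exprD /= (prim_expr_mod prz).
Qed.

Lemma eigen_family_supported : supported eigen_support eigen_family.
Proof.
move=> i v; rewrite inE => /asboolP nS cv; apply: contrapT => v0.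
by apply: nS; exists v => //; apply/eqP.
Qed.

Lemma eigen_family_total v : total eigen_family v.
Proof.
have [F [cF ->]] := power_eigen_decomposition (iter_hat_lin 1) (ltn0Sn s) sK prz Ts v.
elim/big_ind: _ => [|u w tu tw|i _]; first exact: zspan0.
  exact: (zclosedD (zspan_zclosed _)).
by apply: zspan_base; exists i; apply: cF.
Qed.

Lemma eigen_support_root i : i \in eigen_support ->
  exists l : K, [/\ l != 0, laurent_value iota ms ns l = 0 & l ^+ (p ^ e) = z ^+ i].
Proof.
rewrite inE => /asboolP[v cv v0].
have [l [w [w0 Tw le]]] := eigen_of_power (iter_hat_lin 1) pe0 v0 cv.
by exists l; have [] := eigenvalue_laurent_root w0 Tw.
Qed.

(** A root chosen over [i] determines [z ^+ i] as its p^e-th power, hence [i], so the support embeds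
    into the set of roots. *)
Lemma card_eigen_support : (#|eigen_support| <= identity_degree ms)%N.
Proof.
have /choice[l lP] (i : 'I_s.+1) : exists l : K, i \in eigen_support ->
    [/\ l != 0, laurent_value iota ms ns l = 0 & l ^+ (p ^ e) = z ^+ i].
  have [/eigen_support_root[l lP]|_] := boolP (i \in eigen_support); first by exists l.
  by exists 0.
have [z0 z0n vz0] := laurent_nonzero.
rewrite cardE -(size_map l); apply: (laurent_roots_le z0n vz0).
  rewrite map_inj_in_uniq ?enum_uniq // => i j.
  rewrite !mem_enum => /lP[_ _ li] /lP[_ _ lj] lij.
  have := eq_prim_root_expr prz i j; rewrite -li -lj lij eqxx !modn_small //.
  by move=> /esym/eqP/val_inj.
by move=> y /mapP[i]; rewrite mem_enum => /lP[? ? _] ->.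
Qed.

(** Suppose the support contains all i + jn, and let [l] and [u] be roots over [i] and [j]. Then l
    u^n has the same p^e-th power as a root over i + jn, so it equals that root; thus the coset of
    [l] modulo the powers of [u] would consist of roots. *)
Lemma eigen_support_arith_free : arith_free eigen_support.
Proof.
move=> i j iS jS; apply: contrapT => nex.
have Sk n : i + j *+ n \in eigen_support by apply: contrapT => /negP nS; apply: nex; exists n.
have [l [l0 vl le]] := eigen_support_root iS; have [u [u0 vu ue]] := eigen_support_root jS.
case: f_af => _ []; exists (UnitGroup l0), (UnitGroup u0); split=> //.
move=> _ [_ [n _ <-] <-]; rewrite /laurent_roots /=.
have valX (x : unit_group K) q : unit_val (x ^+ q)%g = unit_val x ^+ q.
  by elim: q => [|q IH]; rewrite ?expg0 // expgS exprS -IH.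
have valZ (x : unit_group K) q : unit_val (expgz x q) = unit_val x ^ q.
  by case: q => q; rewrite /= ?valX // NegzE -exprnN -exprVn -valX.
rewrite valZ /=.
have zD (x y : 'I_s.+1) : z ^+ (x + y)%R = z ^+ x * z ^+ y.
  by rewrite -exprD /= (prim_expr_mod prz).
have zM (x : 'I_s.+1) q : z ^+ (x *+ q)%R = z ^+ x ^+ q.
  by elim: q => [|q IH]; rewrite ?mulr0n // mulrS zD IH exprS.
pose q := `|(n %% s.+1%:Z)%Z|%N.
have zn : (z ^+ j) ^ n = z ^+ j ^+ q.
  rewrite {1}(divz_eq n s.+1%:Z) -[(n %% _)%Z]gez0_abs ?modz_ge0 // -/q.
  have zj0 : z ^+ j != 0 by rewrite expf_neq0 // (prim_root_eq0 prz).
  rewrite expfzDr // [(_ %/ _)%Z * _]mulrC -exprz_exp -!exprnP.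
  have -> : z ^+ j ^+ s.+1 = 1 by rewrite -exprM mulnC exprM (prim_expr_order prz) expr1n.
  by rewrite exp1rz mul1r.
have [l' [_ vl' le']] := eigen_support_root (Sk q).
suff -> : l * u ^ n = l' by [].
(* Raising to the power p^e is additive in characteristic [p], hence injective. *)
apply/eqP; rewrite -subr_eq0.
suff : (l * u ^ n - l') ^+ (p ^ e) == 0 by rewrite expf_eq0 => /andP[].
have pnat_pe : [pchar K].-nat (p ^ e)%N.
  by rewrite pnatX; apply/orP; left; rewrite pnatE.
rewrite exprDn_pchar // exprNn_pchar //.
have unE : (u ^ n) ^+ (p ^ e) = (u ^+ (p ^ e)) ^ n.
  by rewrite !exprnP !exprz_exp mulrC.
by rewrite subr_eq0 le' zD zM exprMn le -zn -ue unE.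
Qed.

(** Commutators generate each term and are sent to brackets. The shift arises because [lcs] counts
    from 0 and the group series from 1. *)
Lemma total_frame_vec q : {in L q.+1, forall x, total (lcs br eigen_family q) (emb q.+1 x)}.
Proof.
elim: q => [|q IH] x Lx; first exact: eigen_family_total.
move: x Lx; rewrite lcnSn.
apply: (additive_on_gen (Q := total (lcs br eigen_family q.+1))
  (frame_vec_additive fr iota (q := q.+2))).
- exact: zspan0.
- by move=> u v; exact: zspanB.
- exact: subset_gen.
move=> _ /imset2P[x y Lx Ly ->].
have := frame_bracket_vec p_pr fr iota (ltn0Sn q) (ltn0Sn 0) Lx Ly; rewrite addn1 => <-.
by apply: (total_br frame_bracketBl frame_bracketBr); [exact: IH | exact: eigen_family_total].
Qed.

Lemma lcn_class_bound : L (class_bound #|eigen_support| (2 ^ #|eigen_support|).-1).+1 = 1%g.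
Proof.
set c := class_bound _ _.
have emb0 x : x \in L c.+1 -> emb c.+1 x = 0.
  move=> /total_frame_vec; apply: total_eq0.
  exact: (graded_nilpotent frame_bracketBl frame_bracketBr
    (frame_bracket_leibniz p_pr fr iota) eigen_support_arith_free
    eigen_family_subalgebra eigen_family_supported).
have sub : L c.+1 \subset ('Phi(L c.+1) <*> L c.+2)%g.
  apply/fintype.subsetP => x Lx; apply: (frame_faithful fr) => // a da.
  have := congr1 (fun v : V => v a) (emb0 x Lx); rewrite !ffunE da eqxx.
  by move=> /eqP; rewrite fmorph_eq0 => /eqP.
have eqL : ('Phi(L c.+1) <*> L c.+2)%g = L c.+1.
  by apply/eqP; rewrite finset.eqEsubset sub andbT join_subG Phi_sub lcn_subS.
(* Frattini elements are nongenerators, so the next term alone is everything. In a nilpotent group,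
   however, a nontrivial term of the series strictly contains the next one. *)
have LL : L c.+2 = L c.+1 by have := Phi_nongen eqL; rewrite genGid.
apply/eqP; apply: contraT => nt.
have nL : [set: gT] \subset 'N_[set: gT](L c.+1)%g by rewrite finset.subsetI subxx lcn_norm.
have := nil_comm_properl (pgroup_nil pG) (lcn_sub _ _) nt nL.
by rewrite -lcnSn LL fintype.properxx.
Qed.

End Grading.
End ClassBound.

Lemma lcn_eq1 (p : nat) (K : closedFieldType) (iota : {rmorphism 'F_p -> K})
    (gT : finGroupType) (f : automorphism gT) k (ms ns : 'I_k -> int) :
  prime p -> (p.-group [set: gT])%g -> satisfies_identity f ms ns ->
  identity_arithmetically_free iota ms ns ->
  let m := identity_degree ms in ('L_(m ^ (2 ^ m)).+1([set: gT]) = 1)%g.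
Proof.
move=> p_pr pG f_id f_af m.
have [I [dg [b [phi fr]]]] := lcs_frame_exists (G := [group of [set: gT]]) p_pr pG.
have [N N0 fN] := aut_finite_order f.
have fM : {morph f : x y / (x * y)%g} by exact: gmulfM.
have [[|s] cops Ns] := pfactor_coprime p_pr N0; first by rewrite Ns in N0.
set e := logn p N in Ns.
have pcharK : p \in [pchar K]%R.
  by rewrite inE p_pr -(rmorph_nat iota) pchar_Fp_0 // rmorph0 /=.
have sK : (s.+1%:R != 0 :> K)%R by rewrite -(dvdn_pcharf pcharK) -prime_coprime.
have [z prz] := prim_root_exists sK (ltn0Sn s).
have Ts v : iter s.+1 (iter (p ^ e) (frame_map dg b phi iota f)) v = v.
  have -> : iter s.+1 (iter (p ^ e) (frame_map dg b phi iota f)) v =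
      iter N (frame_map dg b phi iota f) v by rewrite Ns iterM.
  by rewrite -(frame_map_iter p_pr fr) // (frame_map_id fr).
have := lcn_class_bound p_pr pG f_id f_af fr prz sK (e := e) Ts.
have := class_bound_le (card_eigen_support p_pr f_id f_af fr e prz).
move=> le L1; apply/trivgP; rewrite -L1; exact: lcn_sub_leq.
Qed.

(** * The order *)

Section CountLowerCentralSections.
Local Open Scope group_scope.

Lemma card_abelian_gen (gT : finGroupType) (us : seq gT) l : (0 < l)%N ->
  abelian <<[set x in us]>> -> (forall x : gT, x ^+ l = 1) ->
  (#|<<[set x in us]>>| <= l ^ size us)%N.
Proof.
move=> l0 + xl; elim: us => [|x us IH] ab.
  suff -> : [set x in [::]] = set0 :> {set gT} by rewrite gen0 cards1.
  by apply/setP => y; rewrite !inE.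
have E : <<[set y in x :: us]>> = <[x]> <*> <<[set y in us]>>.
  by rewrite set_cons joing_idr joing_idl.
have sub : <<[set y in us]>> \subset <<[set y in x :: us]>>.
  by rewrite E joing_subr.
have cx : <[x]> \subset 'C(<<[set y in us]>>).
  apply: (centSS _ sub ab); by rewrite E joing_subl.
rewrite E cent_joinEl // expnS.
apply: (@leq_trans (#[x] * #|<<[set y in us]>>|)).
  by rewrite /order (mul_cardG <[x]>%G) leq_pmulr // cardG_gt0.
apply: leq_mul; first by apply: dvdn_leq => //; rewrite order_dvdn xl.
by apply: IH; apply: abelianS ab.
Qed.

Variables (gT : finGroupType) (gs : seq gT) (l : nat).
Hypotheses (l0 : (0 < l)%N) (xl : forall x : gT, x ^+ l = 1).
Hypothesis genG : <<[set x in gs]>> = [set: gT].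

Local Notation L q := 'L_q([set: gT]).

(* The left-normed commutators of weight q.+1. *)
Fixpoint lcn_gens q : seq gT :=
  if q is q'.+1 then [seq [~ u, g] | u <- lcn_gens q', g <- gs] else gs.

Lemma size_lcn_gens q : size (lcn_gens q) = (size gs ^ q.+1)%N.
Proof. by elim: q => [|q IH]; rewrite ?expn1 //= size_allpairs IH -expnSr. Qed.

Lemma lcn_gens_sub q : [set x in lcn_gens q] \subset L q.+1.
Proof.
elim: q => [|q IH]; first exact: subsetT.
apply/subsetP => x; rewrite inE => /allpairsP[[u g] /= [uq gg ->]].
rewrite lcnSn mem_commg ?inE //; apply: (subsetP IH); by rewrite inE.
Qed.

(** Let [N] be generated by the commutators of the next weight and [L q.+3]. Modulo [N] the
    generators of [L q.+1] commute with those of the group, so [L q.+1, G] lies in [N]. *)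
Lemma lcn_gens_gen q : <<[set x in lcn_gens q]>> <*> L q.+2 = L q.+1.
Proof.
elim: q => [|q IH].
  by apply/eqP; rewrite eqEsubset subsetT /= genG joing_subl.
have nL i : [set: gT] \subset 'N(L i) by exact: lcn_norm.
set U := <<_>>; set N := (U <*> L q.+3)%G.
have UL : U \subset L q.+2 by rewrite gen_subG lcn_gens_sub.
have NL : N \subset L q.+2 by rewrite join_subG UL lcn_subS.
have cN : [~: N, [set: gT]] \subset N.
  by apply: subset_trans (joing_subr _ _); rewrite lcnSn commSg.
have nN : [set: gT] \subset 'N(N) by rewrite -commg_subl.
have nNs (A : {set gT}) : A \subset 'N(N) by apply: subset_trans nN; apply: subsetT.
apply/eqP; rewrite eqEsubset NL /= lcnSn -/N.
rewrite -quotient_cents2 //.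
have -> : L q.+1 / N = (<<[set x in lcn_gens q]>> / N) <*> (L q.+2 / N).
  by rewrite -quotientY // IH.
rewrite join_subG; apply/andP; split; last first.
  rewrite quotient_cents2 // -lcnSn; exact: joing_subr.
have -> : [set: gT] / N = <<[set x in gs]>> / N by rewrite genG.
rewrite !quotient_gen // gen_subG centsC gen_subG centsC.
apply/centsP => _ /morphimP[u _ + ->] _ /morphimP[g _ + ->]; rewrite !inE => uq gg.
have nNx x : x \in 'N(N) by apply: (subsetP nN); rewrite inE.
apply/commgP; rewrite -morphR //=; apply/eqP/coset_id.
apply: (subsetP (joing_subl _ _)); apply: mem_gen; rewrite inE.
by apply: allpairs_f.
Qed.

Lemma card_lcn_section q : (#|L q.+1| <= l ^ (size gs ^ q.+1) * #|L q.+2|)%N.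
Proof.
have nL : L q.+1 \subset 'N(L q.+2) by case/andP: (lcn_normalS q.+1 [group of [set: gT]]).
rewrite -(Lagrange (lcn_subS q.+1 [group of [set: gT]])) mulnC leq_mul2r -card_quotient //.
apply/orP; right; rewrite -size_lcn_gens -(size_map (coset (L q.+2))).
have sub : [set x in lcn_gens q] \subset 'N(L q.+2).
  exact: subset_trans (lcn_gens_sub q) nL.
have E : L q.+1 / L q.+2 = <<[set x in map (coset (L q.+2)) (lcn_gens q)]>>.
  rewrite -[in LHS](lcn_gens_gen q) quotientYidr ?gen_subG // quotient_gen //.
  congr <<_>>; apply/setP => x; rewrite inE; apply/morphimP/mapP.
    by move=> [y _ + ->]; rewrite inE => yq; exists y.
  by move=> [y yq ->]; exists y => //; [apply: (subsetP sub) |]; rewrite inE.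
rewrite E; apply: card_abelian_gen => //.
  rewrite -E; apply: abelianS (lcn_central q.+1 [group of [set: gT]]) _.
  exact: center_abelian.
move=> x; have [y Ny ->] := cosetP x; by rewrite -morphX //= xl morph1.
Qed.

Lemma card_le_of_lcn_eq1 c : L c.+1 = 1 -> (#|gT| <= l ^ (size gs ^ c.+1))%N.
Proof.
move=> L1; rewrite -cardsT; have [d1|d2] := leqP (size gs) 1.
  have -> : (size gs ^ c.+1 = size gs)%N.
    by case: (size gs) d1 => [|[|]] //; rewrite ?exp0n ?exp1n.
  rewrite -genG; apply: card_abelian_gen => //.
  case: gs d1 => [|x [|]] // _.
    suff -> : [set x in [::]] = set0 :> {set gT} by rewrite gen0 abelian1.
    by apply/setP => y; rewrite !inE.
  suff -> : [set y in [:: x]] = [set x] by exact: cycle_abelian.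
  by apply/setP => y; rewrite !inE.
have bound r q : (q + r)%N = c -> (#|L q.+1| <= l ^ \sum_(i < r) size gs ^ (q + i).+1)%N.
  elim: r q => [|r IH] q qr; first by rewrite addn0 in qr; rewrite qr L1 cards1 expn_gt0 l0.
  apply: leq_trans (card_lcn_section q) _.
  rewrite big_ord_recl addn0 expnD leq_mul2l; apply/orP; right.
  under eq_bigr do rewrite lift0 addnS -addSn.
  by apply: IH; rewrite addSn -addnS.
apply: leq_trans (bound c 0 (add0n c)) _; apply: leq_pexp2l => //.
under eq_bigr do rewrite add0n.
elim: c {L1 bound} => [|c IH]; first by rewrite big_ord0.
rewrite big_ord_recr /= (@leq_trans (size gs ^ c.+1 + size gs ^ c.+1)) //.
  by rewrite leq_add2r.
by rewrite addnn -mul2n [leqRHS]expnS leq_mul2r d2 orbT.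
Qed.

End CountLowerCentralSections.

(** * Reduction to finite groups *)

Section FiniteGroups.
Local Open Scope group_scope.

Lemma pgroup_is_pgroup (p : nat) (gT : finGroupType) : prime p -> is_pgroup p gT ->
  p.-group [set: gT].
Proof.
move=> p_pr pG; apply/pgroupP => q q_pr /(Cauchy q_pr)[x _ xq].
have [n xn] := pG x; have : q %| p ^ n by rewrite -xq order_dvdn xn.
by rewrite (Euclid_dvdX _ _ q_pr) dvdn_prime2 // inE => /andP[].
Qed.

Lemma card_finite_le (p : nat) (K : closedFieldType) (iota : {rmorphism 'F_p -> K})
    (gT : finGroupType) (f : automorphism gT) k (ms ns : 'I_k -> int) l d
    (g : 'I_d -> gT) :
  prime p -> is_pgroup p gT -> (0 < l)%N -> (forall x : gT, x ^+ l = 1) ->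
  <<[set g i | i : 'I_d]>> = [set: gT] ->
  satisfies_identity f ms ns -> identity_arithmetically_free iota ms ns ->
  (#|gT| <= l ^ (d ^ (identity_degree ms ^ (2 ^ identity_degree ms) + 1)))%N.
Proof.
move=> p_pr pG l0 xl genG f_id f_af; rewrite addn1.
have := card_le_of_lcn_eq1 (gs := map g (enum 'I_d)) l0 xl.
rewrite size_map size_enum_ord; apply; last first.
  exact: (lcn_eq1 p_pr (pgroup_is_pgroup p_pr pG) f_id f_af).
rewrite -genG; congr <<_>>; apply/setP => x; rewrite inE; apply/mapP/imsetP => -[i _ ->];
  by exists i => //; rewrite mem_enum.
Qed.

End FiniteGroups.

(** * Finite quotients with a kernel invariant under automorphisms *)

Section FiniteQuotients.
Local Open Scope group_scope.
Variables (G : groupType) (d : nat) (g : 'I_d -> G).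
Hypothesis gen : smallest (@is_subgroup G) (range g) = [set: G]%classic.

Lemma generated_ind (P : G -> Prop) :
  P 1 -> (forall x y, P x -> P y -> P (x * y^-1)) -> (forall i, P (g i)) -> forall x, P x.
Proof.
move=> P1 Pd Pg x; have : smallest (@is_subgroup G) (range g) x by rewrite gen.
apply: (_ : _ -> (fun y => P y) x); apply; split; first by split.
by move=> _ [i _ <-].
Qed.

Lemma morph_group1 (A B : groupType) (h : A -> B) :
  {morph h : x y / x * y} -> h 1 = 1.
Proof.
by move=> hM; apply: (mulgI (h 1)); rewrite -hM !mulg1.
Qed.

Lemma morph_groupV (A B : groupType) (h : A -> B) x :
  {morph h : x y / x * y} -> h x^-1 = (h x)^-1.
Proof.
by move=> hM; apply: (mulgI (h x)); rewrite -hM !mulgV (morph_group1 hM).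
Qed.

Lemma morph_eq_gen (B : groupType) (h h' : G -> B) :
  {morph h : x y / x * y} -> {morph h' : x y / x * y} ->
  (forall i, h (g i) = h' (g i)) -> h =1 h'.
Proof.
move=> hM hM'; apply: generated_ind; first by rewrite !morph_group1.
by move=> x y ex ey; rewrite hM hM' (morph_groupV _ hM) (morph_groupV _ hM') ex ey.
Qed.

Lemma residually_finite_seq (xs : seq G) : residually_finite G ->
  (forall x, x \in xs -> x != 1) ->
  exists (H : finGroupType) (h : G -> H),
    {morph h : x y / x * y} /\ forall x, x \in xs -> h x != 1.
Proof.
move=> rf; elim: xs => [_|x xs IH xs1].
  exists {perm 'I_1}, (fun=> 1); split=> // x y; by rewrite mulg1.
have [|H1 [h1 [hM1 h1n]]] := IH.
  by move=> y yxs; apply: xs1; rewrite inE yxs orbT.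
have [|H2 [h2 h2n]] := rf x; first by apply: xs1; rewrite inE eqxx.
exists (H1 * H2)%type, (fun y => (h1 y, h2 y)); split.
  by move=> y z; rewrite hM1 gmulfM.
move=> y; rewrite inE => /predU1P[->|/h1n].
  by apply: contra h2n => /eqP[_ ->].
by apply: contra => /eqP[-> _].
Qed.

Variable H : finGroupType.

(** A homomorphism is determined by its values on the generators, so the finitely many tuples [h]
    index all of them; a tuple with no extension gets the trivial map. *)
Definition hom_extending (h : {ffun 'I_d -> H}) (x : G) : H :=
  if pselect (exists psi : G -> H, {morph psi : x y / x * y} /\ forall i, psi (g i) = h i)
  is left e then sval (cid e) x else 1.

(* The kernel of all_homs is the intersection of the kernels of all homomorphisms
   to H, which every automorphism of G preserves. *)
Definition all_homs (x : G) : {dffun forall _ : {ffun 'I_d -> H}, H} :=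
  [ffun h => hom_extending h x].

Lemma all_homsM : {morph all_homs : x y / x * y}.
Proof.
move=> x y; apply/ffunP => h; rewrite !ffunE /hom_extending.
case: pselect => [e|_]; last by rewrite mulg1.
by case: cid => psi /= [psiM _]; rewrite psiM.
Qed.

Lemma all_homs_eq x y : all_homs x = all_homs y <->
  forall psi : G -> H, {morph psi : x y / x * y} -> psi x = psi y.
Proof.
split=> [e psi psiM|e].
  have := congr1 (fun F : {dffun forall _ : {ffun 'I_d -> H}, H} => F [ffun i => psi (g i)]) e.
  rewrite !ffunE /hom_extending; case: pselect => [e'|[]]; last first.
    by exists psi; split=> // i; rewrite ffunE.
  case: cid => psi' /= [psiM' e2]; have := morph_eq_gen psiM' psiM; move=> ->.
    by rewrite (morph_eq_gen psiM' psiM) // => i; rewrite e2 ffunE.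
  by move=> i; rewrite e2 ffunE.
apply/ffunP => h; rewrite !ffunE /hom_extending.
by case: pselect => // e'; case: cid => psi /= [psiM _]; apply: e.
Qed.

Lemma all_homs_quotient : exists (Q : finGroupType) (pi : G -> Q),
  [/\ {morph pi : x y / x * y}, forall y, exists x, pi x = y &
     forall x y, pi x = pi y <->
       forall psi : G -> H, {morph psi : x y / x * y} -> psi x = psi y].
Proof.
pose A := [set y : {dffun forall _ : {ffun 'I_d -> H}, H} | `[< exists x, all_homs x = y >]].
have gA : group_set A.
  apply/group_setP; split.
    by rewrite finset.in_set; apply/asboolP; exists 1; rewrite (morph_group1 all_homsM).
  move=> y z; rewrite !finset.in_set => /asboolP[x <-] /asboolP[x' <-].
  by apply/asboolP; exists (x * x'); rewrite all_homsM.
pose P := Group gA.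
have memP x : all_homs x \in P by rewrite finset.in_set; apply/asboolP; exists x.
exists (subg_of P), (fun x => subg P (all_homs x)); split.
- by move=> x y; rewrite all_homsM subgM.
- by move=> y; have := subgP y; rewrite finset.in_set => /asboolP[x e]; exists x; rewrite e sgvalK.
- move=> x y; rewrite -all_homs_eq; split=> [e|-> //].
  by have := congr1 sgval e; rewrite !subgK.
Qed.

End FiniteQuotients.

(** * Passage of an automorphism and its identity to a quotient *)

Section InducedAutomorphism.
Local Open Scope group_scope.
Variables (G : groupType) (Q : finGroupType) (pi : G -> Q).
Hypothesis piM : {morph pi : x y / x * y}.
Hypothesis pi_surj : forall y, exists x, pi x = y.
Variable f : automorphism G.
Hypothesis pi_f : forall x y, pi x = pi y -> pi (f x) = pi (f y).
Hypothesis pi_finv : forall x y, pi x = pi y -> pi (aut_inv f x) = pi (aut_inv f y).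

Lemma induced_automorphism : exists F : automorphism Q,
  forall x, pi (f x) = F (pi x).
Proof.
have [r rK] := choice pi_surj.
pose F0 y := pi (f (r y)); pose F1 y := pi (aut_inv f (r y)).
have F0E x : F0 (pi x) = pi (f x) by apply: pi_f; rewrite rK.
have F1E x : F1 (pi x) = pi (aut_inv f x) by apply: pi_finv; rewrite rK.
have F0M : {morph F0 : x y / x * y}.
  move=> x y; rewrite -[x]rK -[y]rK -piM !F0E -piM; congr (pi _); exact: gmulfM.
have F01 : cancel F0 F1 by move=> y; rewrite -[y]rK F0E F1E aut_funK.
have F10 : cancel F1 F0 by move=> y; rewrite -[y]rK F1E F0E aut_invK.
pose m := isMultiplicative.Build Q Q F0 F0M.
pose F : {multiplicative Q -> Q} := HB.pack F0 m.
by exists (@Automorphism Q F F1 F01 F10) => x; rewrite /= F0E.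
Qed.

Lemma autz_induced (F : automorphism Q) j x :
  (forall x, pi (f x) = F (pi x)) -> autz F j (pi x) = pi (autz f j x).
Proof.
move=> piF; have piFinv y : aut_inv F (pi y) = pi (aut_inv f y).
  by apply: (can_inj (aut_funK F)); rewrite aut_invK -piF aut_invK.
case: j => n; rewrite /autz; first by elim: n => // n IH; rewrite !iterS IH piF.
by elim: n.+1 => // i IH; rewrite !iterS IH piFinv.
Qed.

Lemma satisfies_identity_induced (F : automorphism Q) k (ms ns : 'I_k -> int) :
  (forall x, pi (f x) = F (pi x)) ->
  satisfies_identity f ms ns -> satisfies_identity F ms ns.
Proof.
move=> piF f_id y; have [x <-] := pi_surj y.
have piX z i : pi (z ^+ i) = pi z ^+ i.
  by elim: i => [|i IH]; rewrite ?expg0 ?(morph_group1 piM) // !expgS piM IH.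
have := congr1 pi (f_id x); rewrite (morph_group1 piM) => E; rewrite [LHS]E.
rewrite (big_morph pi piM (morph_group1 piM)); apply: eq_bigr => t _.
rewrite -(autz_induced _ _ piF); congr (autz _ _ _).
by rewrite /expgz; case: (ns t) => i; rewrite ?(morph_groupV _ piM) piX.
Qed.

End InducedAutomorphism.

(** The bound for finite groups applies to a quotient [Q] in which the entries of [s] stay distinct.
    [Q] is built from a finite group [H] in which the nontrivial x y^-1, for x and y in [s], have
    nontrivial images. *)
Lemma size_uniq_le (p : nat) (p_prime : prime p)
    (K : closedFieldType) (iota : {rmorphism 'F_p -> K})
    (G : groupType) (G_resfin : residually_finite G) (G_pgroup : is_pgroup p G)
    (l : nat) (l0 : 0 < l) (xl : forall x : G, (x ^+ l = 1)%g)
    (d : nat) (G_gen : generated_by d G) (f : automorphism G)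
    k (ms ns : 'I_k -> int) (s : seq G) :
  satisfies_identity f ms ns -> identity_arithmetically_free iota ms ns -> uniq s ->
  size s <= l ^ (d ^ (identity_degree ms ^ (2 ^ identity_degree ms) + 1)).
Proof.
move=> f_id f_af us; have [g gen] := G_gen.
pose xs := [seq x <- [seq (x * y^-1)%g | x <- s, y <- s] | x != 1%g].
have [|H [h [hM hn]]] := @residually_finite_seq _ xs G_resfin.
  by move=> x; rewrite mem_filter => /andP[].
have [Q [pi [piM pi_surj pi_eq]]] := all_homs_quotient gen H.
have invM : {morph aut_inv f : x y / (x * y)%g}.
  exact: can2_gmulfM (aut_funK f) (aut_invK f).
have [||F FE] := induced_automorphism piM pi_surj (f := f).
- move=> x y /pi_eq e; apply/pi_eq => psi psiM.
  by apply: (e (psi \o f)) => u v /=; rewrite gmulfM psiM.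
- move=> x y /pi_eq e; apply/pi_eq => psi psiM.
  by apply: (e (psi \o aut_inv f)) => u v /=; rewrite invM psiM.
have piX z i : pi (z ^+ i)%g = (pi z ^+ i)%g.
  by elim: i => [|i IH]; rewrite ?expg0 ?(morph_group1 piM) // !expgS piM IH.
have pQ : is_pgroup p Q.
  move=> y; have [x <-] := pi_surj y; have [n xn] := G_pgroup x.
  by exists n; rewrite -piX xn (morph_group1 piM).
have Ql (y : Q) : (y ^+ l = 1)%g.
  by have [x <-] := pi_surj y; rewrite -piX xl (morph_group1 piM).
have genQ : (<<[set pi (g i) | i : 'I_d]>> = [set: Q])%g.
  apply/eqP; rewrite finset.eqEsubset finset.subsetT /=.
  apply/fintype.subsetP => y _; have [x <-] := pi_surj y; move: x.
  apply: (generated_ind gen); first by rewrite (morph_group1 piM) group1.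
    by move=> u v pu pv; rewrite piM (morph_groupV _ piM) groupM ?groupV.
  by move=> i; apply: mem_gen; apply: imset_f.
have f_idQ := satisfies_identity_induced piM pi_surj FE f_id.
apply: leq_trans (card_finite_le p_prime pQ l0 Ql genQ f_idQ f_af).
rewrite -(size_map pi) -(card_uniqP _) ?max_card // map_inj_in_uniq // => x y xs' ys' e.
apply/eqP; apply: contraT => xy.
have : (h (x * y^-1) != 1)%g.
  apply: hn; rewrite mem_filter; apply/andP; split; last exact: allpairs_f.
  by apply: contra xy => /eqP e1; rewrite -(mulgKV y x) e1 mul1g.
by rewrite hM (morph_groupV _ hM) ((proj1 (pi_eq x y)) e h hM) mulgV eqxx.
Qed.

Theorem corollary5p9 (p : nat) (p_prime : prime p)
    (Fpbar : closedFieldType) (iota : {rmorphism 'F_p -> Fpbar})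
    (Fpbar_closure : is_algebraic_closure iota)
    (G : groupType) (G_resfin : residually_finite G) (G_pgroup : is_pgroup p G)
    (l : nat) (G_exponent : has_exponent l G)
    (d : nat) (G_gen : generated_by d G)
    (m : nat)
    (G_identity : exists (f : automorphism G) (k : nat) (ms ns : 'I_k -> int),
       [/\ satisfies_identity f ms ns,
           identity_degree ms = m &
           identity_arithmetically_free iota ms ns]) :
  finite_set [set: G]%classic /\
  (#|` fset_set [set: G]%classic| <= l ^ (d ^ (m ^ (2 ^ m) + 1)))%N.
Proof.
have [f [k [ms [ns [f_id <- f_af]]]]] := G_identity; have [l0 xl _] := G_exponent.
have bound (A : {fset G}) := size_uniq_le p_prime G_resfin G_pgroup l0 xl G_gen
  f_id f_af (fset_uniq A).
have fin : finite_set [set: G]%classic.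
  apply: contrapT => /infinite_set_fset inf.
  pose B := l ^ (d ^ (identity_degree ms ^ (2 ^ identity_degree ms) + 1)).
  by have [A _] := inf B.+1; rewrite ltnNge bound.
by split=> //; apply: bound.
Qed.
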